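(* Let $\Omega$ be a compact metric space and let $K$ be a kernel on $\Omega\times\Omega$. Assume that there exists a measure $\mu\in\mathbb P(\Omega)$ which is $K$-invariant, i.e. $U_K^\mu(x)=I_K(\mu)$ for all $x\in\Omega$, and has full support, i.e. $\operatorname{supp}(\mu)=\Omega$. Then the following conditions are equivalent: (1) $K$ is positive definite modulo an additive constant. (2) $K$ is conditionally positive definite. (3) $\mu$ is a (directional) local minimizer of $I_K$ in $\mathbb P(\Omega)$. (4) $\mu$ is a global minimizer of $I_K$ over $\mathbb P(\Omega)$. (5) $\mu$ is a global minimizer of $I_K$ over $\widetilde{\mathbb P}(\Omega)$. (6) $I_K$ is convex on $\mathbb P(\Omega)$ (or, equivalently, on $\widetilde{\mathbb P}(\Omega)$). (7) $I_K$ is convex at $\mu$. (8) The inequality $I_K(\mu_1,\mu_2)\le\frac12\big(I_K(\mu_1)+I_K(\mu_2)\big)$ holds for all $\mu_1,\mu_2\in\mathbb P(\Omega)$ (or, equivalently, for all $\mu_1,\mu_2\in\widetilde{\mathbb P}(\Omega)$). (9) The inequality $I_K(\mu,\mu_2)\le\frac12\big(I_K(\mu)+I_K(\mu_2)\big)$ holds for all $\mu_2\in\mathbb P(\Omega)$. (10) The kernel $K$ can be represented as $$K(x,y)=\sum_{j=1}^{\dim(L^2(\Omega,\mu))}\lambda_j\phi_j(x)\phi_j(y)$$ for some functions $\phi_j:\Omega\to\mathbb R$ and real numbers $\lambda_j$, where the series converges uniformly and absolutely, the function $\phi_1$ is constant, and $\lambda_j\ge 0$ for $j\ge 2$.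
   Context: A kernel on $\Omega\times\Omega$ is a continuous symmetric function $K:\Omega\times\Omega\to\mathbb R$. $\mathcal M(\Omega)$ is the set of finite regular signed Borel measures on $\Omega$; $\mathbb P(\Omega)$ the Borel probability measures; $\widetilde{\mathbb P}(\Omega)$ the set of $\nu\in\mathcal M(\Omega)$ with $\nu(\Omega)=1$; $\mathcal Z(\Omega)$ the set of $\nu\in\mathcal M(\Omega)$ with $\nu(\Omega)=0$. For $\mu,\nu\in\mathcal M(\Omega)$: $I_K(\mu,\nu)=\int_\Omega\int_\Omega K(x,y)\,d\mu(x)\,d\nu(y)$, $I_K(\mu)=I_K(\mu,\mu)$, and $U_K^\mu(x)=\int_\Omega K(x,y)\,d\mu(y)$. $K$ is positive definite if $I_K(\nu)\ge0$ for every $\nu\in\mathcal M(\Omega)$; conditionally positive definite if $I_K(\nu)\ge 0$ for every $\nu\in\mathcal Z(\Omega)$; positive definite modulo an additive constant if $K+C$ is positive definite for some $C\in\mathbb R$. A measure $\mu\in\mathbb P(\Omega)$ is a (directional) local minimizer of $I_K$ in $\mathbb P(\Omega)$ if for each $\nu\in\mathbb P(\Omega)$ there exists $\tau_\nu\in(0,1]$ such that $I_K((1-t)\mu+t\nu)\ge I_K(\mu)$ for all $t\in[0,\tau_\nu]$. $I_K$ is convex at $\mu\in\mathbb P(\Omega)$ if for every $\nu\in\mathbb P(\Omega)$ there is $t_\nu\in(0,1]$ such that for all $t\in[0,t_\nu)$, $I_K((1-t)\mu+t\nu)\le(1-t)I_K(\mu)+tI_K(\nu)$. $I_K$ is convex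 on $\mathbb P(\Omega)$ (respectively $\widetilde{\mathbb P}(\Omega)$) if this inequality holds for all $\mu,\nu$ in that set and all $t\in[0,1]$. $\dim(L^2(\Omega,\mu))$ may be infinite, in which case the sum is an infinite series over $j\ge1$. *)

(* Defs.v *)
From HB Require Import structures.
From mathcomp Require Import all_boot all_order all_algebra.
From mathcomp Require Import all_classical all_reals all_analysis.

Set Implicit Arguments.
Unset Strict Implicit.
Unset Printing Implicit Defensive.

Import Order.TTheory GRing.Theory Num.Theory.
Import numFieldNormedType.Exports.

Local Open Scope classical_set_scope.
Local Open Scope ring_scope.

(* The base point is required by the library's measurableType; it only says
   that the space is nonempty, as is any space carrying a probability. *)
#[short(type="pmetricType")]
HB.structure Definition PointedMetric (K : numDomainType) :=
  { M of Metric K M & Pointed M }.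

Definition borel (T : ptopologicalType) := g_sigma_algebraType (@open T).

Section charge_integral.
Context d (X : measurableType d) (R : realType).
Implicit Type nu : {charge set X -> \bar R}.

(* A Hahn decomposition is unique only up to null sets; the objects below do
   not depend, on measurable sets, on the one that is chosen here. *)
Definition hahn_pos nu : set X := projT1 (cid (Hahn_decomposition nu)).

Definition hahn_neg nu : set X :=
  projT1 (cid (projT2 (cid (Hahn_decomposition nu)))).

Definition hahnP nu : hahn_decomposition nu (hahn_pos nu) (hahn_neg nu) :=
  projT2 (cid (projT2 (cid (Hahn_decomposition nu)))).

Definition cintegral nu (f : X -> R) : R :=
  \int[jordan_pos (hahnP nu)]_x f x - \int[jordan_neg (hahnP nu)]_x f x.

Definition charge_total_variation nu : set X -> \bar R := charge_variation (hahnP nu).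

(* (1 - t) mu + t nu *)
Definition mix (t : R) (mu nu : {charge set X -> \bar R}) :
  {charge set X -> \bar R} := cadd (cscale (1 - t) mu) (cscale t nu).

End charge_integral.

Section measures.
Context (R : realType) (T : pmetricType R).

Local Notation charges := (charge (borel T) R).

Definition regular (nu : charges) : Prop :=
  forall (A : set (borel T)), measurable A -> forall e : R, 0 < e ->
  exists F U : set T, [/\ compact F, open U, F `<=` A, A `<=` U &
    (charge_total_variation nu (U `\` F) < e%:E)%E].

(* M(Omega) *)
Definition signed_measures : set charges := [set nu | regular nu].

Definition of_probability (p : probability (borel T) R) : charges :=
  charge_of_finite_measure p.

(* P(Omega) *)
Definition probabilities : set charges := range of_probability.

(* P~(Omega) *)
Definition signed_probabilities : set charges :=
  [set nu | signed_measures nu /\ nu setT = 1%E].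

(* Z(Omega) *)
Definition neutral_measures : set charges :=
  [set nu | signed_measures nu /\ nu setT = 0%E].

Definition supp (mu : probability (borel T) R) : set T :=
  [set x | forall U : set T, open U -> U x -> (0 < mu U)%E].

End measures.

Section energy.
Context (R : realType) (T : pmetricType R).
Implicit Types (K : T * T -> R) (mu nu : charge (borel T) R)
  (S : set (charge (borel T) R)).

Definition is_kernel K : Prop :=
  continuous K /\ forall x y : T, K (x, y) = K (y, x).

Definition mutual_energy K mu nu : R :=
  cintegral nu (fun y => cintegral mu (fun x => K (x, y))).

Definition energy K mu : R := mutual_energy K mu mu.

Definition potential K mu (x : T) : R := cintegral mu (fun y => K (x, y)).

Definition invariant_measure K mu : Prop :=
  forall x : T, potential K mu x = energy K mu.

Definition positive_definite K : Prop :=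
  forall nu, signed_measures nu -> 0 <= energy K nu.

Definition conditionally_positive_definite K : Prop :=
  forall nu, neutral_measures nu -> 0 <= energy K nu.

Definition positive_definite_mod_constant K : Prop :=
  exists C : R, positive_definite (fun z => K z + C).

Definition local_minimizer K mu : Prop :=
  probabilities mu /\
  forall nu, probabilities nu -> exists tau : R, 0 < tau <= 1 /\
    forall t : R, 0 <= t <= tau -> energy K mu <= energy K (mix t mu nu).

Definition global_minimizer_over S K mu : Prop :=
  S mu /\ forall nu, S nu -> energy K mu <= energy K nu.

Definition energy_convex_on S K : Prop :=
  forall mu nu, S mu -> S nu -> forall t : R, 0 <= t <= 1 ->
    energy K (mix t mu nu) <= (1 - t) * energy K mu + t * energy K nu.

Definition energy_convex_at K mu : Prop :=
  probabilities mu /\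
  forall nu, probabilities nu -> exists t0 : R, 0 < t0 <= 1 /\
    forall t : R, 0 <= t < t0 ->
      energy K (mix t mu nu) <= (1 - t) * energy K mu + t * energy K nu.

Definition midpoint_inequality K mu nu : Prop :=
  mutual_energy K mu nu <= 2^-1 * (energy K mu + energy K nu).

End energy.

Section L2.
Context d (X : measurableType d) (R : realType).
Variable mu : {measure set X -> \bar R}.

Definition L2fun := LfunType mu (@lee1n R 2).

(* Linear independence in L^2(mu), i.e. modulo equality almost everywhere. *)
Definition L2_independent (n : nat) (f : 'I_n -> L2fun) : Prop :=
  forall c : 'I_n -> R,
    (\sum_(i < n) c i *: f i : L2fun) = (0 : L2fun) %[ae mu] ->
    forall i, c i = 0.

(* A natural number or +oo.  Since L^2 of a compact metric space is separable,
   the value +oo corresponds to a countably infinite orthonormal basis. *)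
Definition L2_dim : \bar R :=
  ereal_sup [set (n%:R)%:E | n in
    [set n | exists f : 'I_n -> L2fun, L2_independent f]].

End L2.

Section expansion.
Context (R : realType) (T : pmetricType R).

(* Indices start at 0: the j-th term below is the (j+1)-st of the sum, and is
   present when j < dim L^2(mu), i.e. for 1 <= j + 1 <= dim L^2(mu). *)
Definition expansion_term (mu : probability (borel T) R) (lambda : nat -> R)
    (phi : nat -> T -> R) (j : nat) (z : T * T) : R :=
  if (j%:R%:E < L2_dim mu)%E then lambda j * phi j z.1 * phi j z.2 else 0.

Definition has_expansion (mu : probability (borel T) R) (K : T * T -> R) :
    Prop :=
  exists (lambda : nat -> R) (phi : nat -> T -> R),
    let u := expansion_term mu lambda phi in
    [/\ {uniform, (fun n z => \sum_(0 <= j < n) u j z) @ \oo --> K},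
        forall z, cvgn (series (fun j => `|u j z|)),
        exists c : R, forall x, phi 0%N x = c &
        forall j, (0 < j)%N -> (j%:R%:E < L2_dim mu)%E -> 0 <= lambda j].

End expansion.

(* Main.v *)
Require Import Defs.
From HB Require Import structures.
From mathcomp Require Import all_boot all_order all_algebra.
From mathcomp Require Import all_classical all_reals all_analysis.
From mathcomp Require Import measurable_realfun.
From mathcomp Require Import ring lra.

Set Implicit Arguments.
Unset Strict Implicit.
Unset Printing Implicit Defensive.

Import Order.TTheory GRing.Theory Num.Theory.
Import numFieldNormedType.Exports.
Local Open Scope classical_set_scope.
Local Open Scope ring_scope.

(** Write I for the energy and m for the charge of [mu]. Invariance of [mu] says
    that the potential of m is the constant I(m), so that I(m, nu) is I(m) nu(T)
    for every charge nu. The energy is therefore exactly quadratic around m: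
    adding a neutral charge nu to m changes the energy by I(nu). This makes
    every condition on m a statement about the sign of I on neutral charges.
    Along the segment from m to a probability nu the energy is I(m) + t^2 (I(nu)
    - I(m)) ([energy_mix_invariant]), so that local and global minimality,
    convexity at m and the midpoint inequality at m all say that I(nu) >= I(m).
    For two charges of mass one, convexity and the midpoint inequality both say
    that I is nonnegative at their difference ([conditionally_midpoint],
    [midpoint_convex]).

    What remains on that side is to go from probabilities back to all neutral
    charges. A neutral charge with a bounded density with respect to [mu] can be
    scaled so that its sum with m is a probability, so minimality over the
    probabilities makes its energy nonnegative ([dominated_neutral_energy_ge0]).
    Because [mu] has full support it charges all balls, and by uniform
    continuity of the kernel the energy of an arbitrary charge is approximated
    by that of a finite combination of normalized restrictions of [mu] to small
    balls with the same total mass ([energy_approx]).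

    For the additive constant, subtract from nu the multiple nu(T) m: the result
    is neutral and has energy I(nu) - I(m) nu(T)^2, the energy of nu for the
    kernel K - I(m) ([conditionally_positive_shift]).

    The expansion uses no spectral theory. The kernel H = K - I(m) is positive
    semidefinite, and the pivoted Cholesky algorithm is run on it: each step
    picks a point where the diagonal of the current remainder is within a factor
    two of its supremum and subtracts the rank one kernel that makes the
    remainder vanish at that point, which leaves a semidefinite kernel
    ([semidefinite_schur]). Large pivots are separated in the pseudometric
    defined by H, so by compactness the pivots tend to zero
    ([pivot_value_small]); a semidefinite kernel is bounded by its diagonal, so
    the remainders tend to zero uniformly, and the same bound applied to each
    term gives absolute convergence. The terms are not too many: the first n + 1
    nonzero pivots sit at distinct points, and since the remainder still has
    integral zero against [mu] there is one more point, hence n + 2 disjoint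
    balls whose indicators are independent in L^2 ([pivot_value_L2_dim]).
    Together with the constant term this respects the dimension of L^2.
    Conversely an expansion makes the energy of a neutral combination of point
    masses a limit of sums of squares, and such combinations approximate every
    neutral charge ([expansion_conditionally]). *)

(** * Bounded measurable functions and their integrals against charges *)

Section bounded_measurable.
Context d (X : measurableType d) (R : realType).
Implicit Types (f g : X -> R).

Definition bounded_measurable f :=
  measurable_fun setT f /\ exists M : R, forall x, `|f x| <= M.

Lemma bounded_measurable_integrable (p : {finite_measure set X -> \bar R}) f :
  bounded_measurable f -> p.-integrable setT (EFin \o f).
Proof.
move=> [mf [M fM]]; apply: measurable_bounded_integrable => //.
  by rewrite -ge0_fin_numE// fin_num_measure.
exists M; split; first exact: num_real.
by move=> y My x _ /=; rewrite (le_trans (fM x))// ltW.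
Qed.

Lemma bounded_measurable_cst c : bounded_measurable (fun=> c : R).
Proof. by split; [exact: measurable_cst|exists `|c|]. Qed.

Lemma bounded_measurableD f g : bounded_measurable f -> bounded_measurable g ->
  bounded_measurable (fun x => f x + g x).
Proof.
move=> [mf [M fM]] [mg [N gN]]; split; first exact: measurable_funD.
by exists (M + N) => x; rewrite (le_trans (ler_normD _ _))// lerD.
Qed.

Lemma bounded_measurableZ c f : bounded_measurable f ->
  bounded_measurable (fun x => c * f x).
Proof.
move=> [mf [M fM]]; split.
  by apply: measurable_funM => //; exact: measurable_cst.
by exists (`|c| * M) => x; rewrite normrM ler_wpM2l.
Qed.

Lemma bounded_measurableB f g : bounded_measurable f -> bounded_measurable g ->
  bounded_measurable (fun x => f x - g x).
Proof.
move=> bf bg; have := bounded_measurableD bf (bounded_measurableZ (-1) bg).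
by under eq_fun do rewrite mulN1r.
Qed.

Lemma bounded_measurable_indic (A : set X) : measurable A ->
  bounded_measurable (\1_A : X -> R).
Proof.
move=> mA; split; first exact: measurable_indic.
by exists 1 => x; rewrite indicE; case: (_ \in _); rewrite ?normr1 ?normr0.
Qed.

Lemma bounded_measurable_sum I (s : seq I) (F : I -> X -> R) :
  (forall i, bounded_measurable (F i)) ->
  bounded_measurable (fun x => \sum_(i <- s) F i x).
Proof.
move=> bF; elim: s => [|i s ih].
  by under eq_fun do rewrite big_nil; exact: bounded_measurable_cst.
by under eq_fun do rewrite big_cons; exact: bounded_measurableD.
Qed.

End bounded_measurable.

Section measure_add_finite.
Context d (X : measurableType d) (R : realType).
Variables p q : {finite_measure set X -> \bar R}.

Let measure_add_finite : fin_num_fun (measure_add p q).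
Proof.
move=> A mA; have -> : measure_add p q A = (p A + q A)%E by exact: measure_addE.
by rewrite fin_numD !fin_num_measure.
Qed.

HB.instance Definition _ := Measure.on (measure_add p q).
HB.instance Definition _ := @Measure_isFinite.Build _ _ _
  (measure_add p q) measure_add_finite.

Lemma fine_measure_add A : measurable A ->
  fine (measure_add p q A) = fine (p A) + fine (q A).
Proof.
move=> mA; rewrite -fineD ?fin_num_measure//; congr fine.
exact: measure_addE.
Qed.

End measure_add_finite.

Section integral_charge.
Context d (X : measurableType d) (R : realType).
Implicit Types (nu : {charge set X -> \bar R}) (f g : X -> R).
Implicit Types (p q : {finite_measure set X -> \bar R}).

Lemma charge_fin_num nu A : measurable A -> nu A \is a fin_num.
Proof. exact: fin_num_measure. Qed.

Lemma Rintegral_measure_add p q f : bounded_measurable f ->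
  \int[measure_add p q]_x f x = \int[p]_x f x + \int[q]_x f x.
Proof.
move=> bf; have ip := bounded_measurable_integrable p bf.
have iq := bounded_measurable_integrable q bf.
rewrite /Rintegral integral_measure_add//.
by rewrite fineD//; exact: integrable_fin_num.
Qed.

Lemma jordan_decomp_fine nu A : measurable A -> fine (nu A) =
  fine (jordan_pos (hahnP nu) A) - fine (jordan_neg (hahnP nu) A).
Proof.
move=> mA; rewrite (jordan_decomp (hahnP nu) mA) /cadd/= cscaleN1.
by rewrite fineB// fin_num_measure.
Qed.

(** The integral against a charge is defined by a Hahn decomposition, which does
    not behave well under sums. It can be computed from any decomposition of the
    charge as a difference of finite measures, because two such decompositions
    become equal measures after cross addition. Linearity in the charge
    follows. *)
Lemma cintegralE nu p q f : bounded_measurable f ->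
  (forall A, measurable A -> fine (nu A) = fine (p A) - fine (q A)) ->
  cintegral nu f = \int[p]_x f x - \int[q]_x f x.
Proof.
move=> bf nupq; rewrite /cintegral.
pose P : {finite_measure set X -> \bar R} := jordan_pos (hahnP nu).
pose N : {finite_measure set X -> \bar R} := jordan_neg (hahnP nu).
rewrite -/P -/N.
suff : \int[P]_x f x + \int[q]_x f x = \int[p]_x f x + \int[N]_x f x by lra.
rewrite -!Rintegral_measure_add// /Rintegral; congr fine.
apply: eq_measure_integral => A mA _.
have fine_inj (x y : \bar R) : x \is a fin_num -> y \is a fin_num ->
    fine x = fine y -> x = y by move=> /fineK {2}<- /fineK {2}<- ->.
apply: fine_inj; [exact: fin_num_measure|exact: fin_num_measure|].
transitivity (fine (P A) + fine (q A)); first exact: fine_measure_add.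
transitivity (fine (p A) + fine (N A)); last exact/esym/fine_measure_add.
have := jordan_decomp_fine nu mA; rewrite nupq// -/P -/N; lra.
Qed.

Lemma eq_cintegral_charge nu nu' f : bounded_measurable f ->
  (forall A, measurable A -> fine (nu A) = fine (nu' A)) ->
  cintegral nu f = cintegral nu' f.
Proof.
move=> bf nn'; apply: cintegralE => // A mA.
by rewrite nn'// jordan_decomp_fine.
Qed.

Lemma cintegral_cst nu c : cintegral nu (fun=> c) = c * fine (nu setT).
Proof.
rewrite /cintegral !Rintegral_cst// -mulrBr; congr *%R.
by rewrite jordan_decomp_fine.
Qed.

Lemma cintegralD nu f g : bounded_measurable f -> bounded_measurable g ->
  cintegral nu (fun x => f x + g x) = cintegral nu f + cintegral nu g.
Proof.
move=> bf bg; rewrite /cintegral !RintegralD//;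
  try exact: bounded_measurable_integrable.
by lra.
Qed.

Lemma cintegralZ nu c f : bounded_measurable f ->
  cintegral nu (fun x => c * f x) = c * cintegral nu f.
Proof.
move=> bf; rewrite /cintegral !RintegralZl//;
  try exact: bounded_measurable_integrable.
by rewrite mulrBr.
Qed.

Lemma cintegralB nu f g : bounded_measurable f -> bounded_measurable g ->
  cintegral nu (fun x => f x - g x) = cintegral nu f - cintegral nu g.
Proof.
move=> bf bg; rewrite /cintegral !RintegralB//;
  try exact: bounded_measurable_integrable.
by lra.
Qed.

Lemma cintegral_sum nu I (s : seq I) (F : I -> X -> R) :
  (forall i, bounded_measurable (F i)) ->
  cintegral nu (fun x => \sum_(i <- s) F i x) =
  \sum_(i <- s) cintegral nu (F i).
Proof.
move=> bF; elim: s => [|i s ih].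
  by under eq_fun do rewrite big_nil; rewrite cintegral_cst mul0r big_nil.
under eq_fun do rewrite big_cons.
by rewrite big_cons cintegralD// ?ih//; exact: bounded_measurable_sum.
Qed.

Lemma cintegral_indic nu A : measurable A ->
  cintegral nu (\1_A : X -> R) = fine (nu A).
Proof.
move=> mA; rewrite /cintegral /Rintegral !integral_indic// setIT.
by rewrite jordan_decomp_fine.
Qed.

Lemma fine_cadd nu nu' A : measurable A ->
  fine (cadd nu nu' A) = fine (nu A) + fine (nu' A).
Proof. by move=> mA; apply: fineD; exact: charge_fin_num. Qed.

Lemma fine_cscale c nu A : measurable A ->
  fine (cscale c nu A) = c * fine (nu A).
Proof. by move=> mA; apply: fineM => //; exact: charge_fin_num. Qed.

Lemma cintegral_cadd nu nu' f : bounded_measurable f ->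
  cintegral (cadd nu nu') f = cintegral nu f + cintegral nu' f.
Proof.
move=> bf.
pose p : {finite_measure set X -> \bar R} := jordan_pos (hahnP nu).
pose q : {finite_measure set X -> \bar R} := jordan_neg (hahnP nu).
pose p' : {finite_measure set X -> \bar R} := jordan_pos (hahnP nu').
pose q' : {finite_measure set X -> \bar R} := jordan_neg (hahnP nu').
have pE A : measurable A -> fine (cadd nu nu' A) =
    fine (measure_add p p' A) - fine (measure_add q q' A).
  move=> mA; rewrite fine_cadd// (jordan_decomp_fine nu mA).
  rewrite (jordan_decomp_fine nu' mA) (fine_measure_add p p' mA).
  by rewrite (fine_measure_add q q' mA) -/p -/q -/p' -/q'; lra.
rewrite (cintegralE bf pE) !Rintegral_measure_add// /cintegral.
rewrite -/p -/q -/p' -/q'.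
by lra.
Qed.

Lemma cintegral_copp nu f : bounded_measurable f ->
  cintegral (copp nu) f = - cintegral nu f.
Proof.
move=> bf; rewrite /cintegral opprB.
apply: cintegralE => // A mA; rewrite /copp/= fineN jordan_decomp_fine//.
by rewrite opprB.
Qed.

Lemma cintegral_cscale c nu f : bounded_measurable f ->
  cintegral (cscale c nu) f = c * cintegral nu f.
Proof.
move=> bf.
(* a measure can only be scaled by a nonnegative factor *)
wlog c0 : c / 0 <= c => [h|].
  have [/h//|c0] := leP 0 c.
  have /h : 0 <= - c by lra.
  rewrite mulNr => /eqP; rewrite -eqr_oppLR => /eqP <-.
  rewrite -cintegral_copp//; apply: eq_cintegral_charge => // A mA.
  by rewrite !fine_cscale// fineN fine_cscale// mulNr opprK.
pose k := NngNum c0.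
pose p : {finite_measure set X -> \bar R} := jordan_pos (hahnP nu).
pose q : {finite_measure set X -> \bar R} := jordan_neg (hahnP nu).
have fineZ (r : {finite_measure set X -> \bar R}) A : measurable A ->
    fine (mscale k r A) = c * fine (r A).
  by move=> mA; apply: fineM => //; exact: fin_num_measure.
have iZ (r : {finite_measure set X -> \bar R}) :
    \int[mscale k r]_x f x = c * \int[r]_x f x.
  (* adding a constant makes f nonnegative *)
  have [M fM] := bf.2.
  have bfM : bounded_measurable (fun x => f x + M).
    by apply: bounded_measurableD => //; exact: bounded_measurable_cst.
  have fM0 x : 0 <= f x + M.
    by have := fM x; rewrite ler_norml => /andP[? _]; rewrite -lerBlDr sub0r.
  have shift (m : {finite_measure set X -> \bar R}) :
      \int[m]_x f x = \int[m]_x (f x + M) - M * fine (m setT).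
    rewrite RintegralD ?Rintegral_cst ?addrK//.
      exact: bounded_measurable_integrable.
    by apply: bounded_measurable_integrable; exact: bounded_measurable_cst.
  rewrite (shift r) (shift (mscale k r)) mulrBr; congr (_ - _).
    rewrite /Rintegral ge0_integral_mscale//.
    - rewrite fineM//; apply: integrable_fin_num => //.
      exact: bounded_measurable_integrable.
    - by apply/measurable_EFinP; exact: bfM.1.
    - by move=> x _; rewrite lee_fin.
  by rewrite (fineZ r setT measurableT) mulrCA.
rewrite (cintegralE (p := mscale k p) (q := mscale k q) bf).
  by rewrite (iZ p) (iZ q) -mulrBr.
move=> A mA; rewrite fine_cscale// (jordan_decomp_fine nu mA).
by rewrite (fineZ p A mA) (fineZ q A mA) mulrBr.
Qed.

Definition total_mass nu : R := fine (charge_total_variation nu setT).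

Lemma total_mass_ge0 nu : 0 <= total_mass nu.
Proof. by rewrite fine_ge0//; exact: measure_ge0. Qed.

Lemma cintegral_le nu f C : bounded_measurable f -> (forall x, `|f x| <= C) ->
  `|cintegral nu f| <= C * total_mass nu.
Proof.
move=> bf fC; have i p : `|\int[p]_x f x| <= C * fine (p setT).
  have ip := bounded_measurable_integrable p bf.
  rewrite -Rintegral_cst//.
  apply: le_trans (le_normr_Rintegral measurableT ip) _.
  apply: le_Rintegral => //.
    exact: integrable_norm.
  by apply: bounded_measurable_integrable; exact: bounded_measurable_cst.
rewrite /total_mass /charge_total_variation /charge_variation.
rewrite fineD ?fin_num_measure// mulrDr (le_trans (ler_normB _ _))// lerD//.
  exact: (i (jordan_pos (hahnP nu))).
exact: (i (jordan_neg (hahnP nu))).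
Qed.

End integral_charge.

(** * Regularity of charges on a compact metric space *)

Section borel_metric.
Context (R : realType) (T : pmetricType R).
Local Notation charges := (charge (borel T) R).
Implicit Types (nu : charges) (p : {finite_measure set (borel T) -> \bar R}).

Lemma borel_open (U : set T) : open U -> measurable (U : set (borel T)).
Proof. exact: sub_sigma_algebra. Qed.

Lemma borel_closed (F : set T) : closed F -> measurable (F : set (borel T)).
Proof.
move=> cF; rewrite -[F]setCK; apply: measurableC; apply: borel_open.
exact: closed_openC.
Qed.

Lemma open_mball (x : T) (r : R) : open (ball x r).
Proof.
rewrite openE => y xy; have xy' : mdist x y < r by move: xy; rewrite ballEmdist.
apply/nbhs_ballP; exists (r - mdist x y); first by rewrite /= subr_gt0.
move=> z; rewrite !ballEmdist/= => yz.
by have := metric_triangle x y z; lra.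
Qed.

Lemma borel_ball (x : T) (r : R) : measurable (ball x r : set (borel T)).
Proof. by apply: borel_open; exact: open_mball. Qed.

Lemma continuous_borel (f : T -> R) : continuous f ->
  measurable_fun setT (f : borel T -> R).
Proof.
move=> cf; apply: (measurability _ (RGenOpens.measurableE R)).
move=> _ [_ [a [b ->]] <-]; rewrite setTI; apply: borel_open.
by move/continuousP : cf; apply; exact: interval_open.
Qed.

Lemma finite_measure_nonincreasing_small p (D : nat -> set (borel T)) (e : R) :
  (forall n, measurable (D n)) -> {homo D : n m / (n <= m)%N >-> (m `<=` n)} ->
  \bigcap_n D n = set0 -> 0 < e -> exists n, (p (D n) < e%:E)%E.
Proof.
move=> mD homoD D0 e0.
have : p \o D @ \oo --> p (\bigcap_n D n).
  apply: nonincreasing_cvg_mu => //.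
  - by rewrite -ge0_fin_numE// fin_num_measure.
  - exact: bigcap_measurable.
  - by move=> n m nm; apply/subsetPset; exact: homoD.
rewrite D0 measure0 => /fine_cvgP[fD /cvgrPdist_lt /(_ _ e0) hD].
have [n [fn hn]] : exists n, p (D n) \is a fin_num /\ `|0 - fine (p (D n))| < e.
  have [n _ /(_ n (leqnn _))[? ?]] := filterI fD hD.
  by exists n.
exists n; rewrite -(fineK fn) lte_fin.
by move: hn; rewrite sub0r normrN; apply: le_lt_trans; exact: ler_norm.
Qed.

Definition closed_open_approximable p (A : set T) := forall e : R, 0 < e ->
  exists F U : set T, [/\ closed F, open U, F `<=` A, A `<=` U &
    (p (U `\` F) < e%:E)%E].

Lemma measurable_openD_closed (F U : set T) : closed F -> open U ->
  measurable (U `\` F : set (borel T)).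
Proof.
by move=> ? ?; apply: measurableD; [exact: borel_open|exact: borel_closed].
Qed.

(** An open set is the increasing union of the closed sets of points at distance
    at least [n.+1%:R^-1] from its complement. *)
Lemma open_approximable p (U : set T) : open U -> closed_open_approximable p U.
Proof.
move=> oU e e0.
pose F n : set T := ~` \bigcup_(y in ~` U) ball y n.+1%:R^-1.
have cF n : closed (F n).
  by apply: open_closedC; apply: bigcup_open => y _; exact: open_mball.
have NFE n x : ~ F n x <-> exists2 y, ~ U y & ball y n.+1%:R^-1 x.
  split=> [/contrapT[y Uy yx]|[y Uy yx] Fx]; first by exists y.
  by apply: Fx; exists y.
have [n pn] : exists n, (p (U `\` F n) < e%:E)%E.
  apply: finite_measure_nonincreasing_small e0.
  - by move=> n; exact: measurable_openD_closed.
  - move=> n m nm x [Ux /NFE[y Uy yx]]; split => //.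
    apply/NFE; exists y => //; apply: le_ball yx.
    by rewrite lef_pV2 ?posrE// ler_nat ltnS.
  - rewrite -subset0 => x DFx; have [Ux _] := DFx 0%N I.
    have /nbhs_ballP[d /= d0 dU] : nbhs x U by exact: open_nbhs_nbhs.
    have [n nd] := ltr_add_invr d0.
    have [_ /NFE[y Uy /ball_sym yx]] := DFx n I.
    by apply: Uy; apply: dU; apply: le_ball yx; rewrite add0r in nd; exact: ltW.
exists (F n), U; split => // x Fx; apply: contrapT => Ux; apply: Fx.
by exists x => //; apply: ballxx; rewrite invr_gt0.
Qed.

(** The sets that are approximated within any error by a closed set from inside
    and an open set from outside form a sigma-algebra, which contains the open
    sets. *)
Lemma finite_measure_approximable p (A : set (borel T)) : measurable A ->
  closed_open_approximable p A.
Proof.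
move: A; apply: smallest_sub; last by move=> U oU; exact: open_approximable.
split.
- move=> e e0; exists set0, set0; split => //; [exact: closed0|exact: open0|].
  by rewrite setD0 measure0 lte_fin.
- move=> A hA e /hA[F [U [cF oU FA AU pe]]]; exists (~` U), (~` F); split.
  + exact: open_closedC.
  + exact: closed_openC.
  + by rewrite setTD; exact: subsetC.
  + by rewrite setTD; exact: subsetC.
  + by rewrite setDE setCK setIC -setDE.
- move=> A hA e e0; have e20 : 0 < e / 2 by rewrite divr_gt0.
  have /choice[F /choice[U FU]] : forall n, exists F U : set T,
      [/\ closed F, open U, F `<=` A n, A n `<=` U &
        (p (U `\` F) < (e / 2 / (2 ^ n.+1)%:R)%:E)%E].
    by move=> n; apply: hA; rewrite divr_gt0// ltr0n expn_gt0.
  pose V := \bigcup_n U n.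
  have oV : open V by apply: bigcup_open => n _; have [] := FU n.
  pose G n := \big[setU/set0]_(k < n) F k.
  have cG n : closed (G n) by apply: closed_bigsetU => k _; have [] := FU k.
  pose W := \bigcup_n F n.
  have mW : measurable (W : set (borel T)).
    by apply: bigcup_measurable => n _; apply: borel_closed; have [] := FU n.
  have mV := borel_open oV.
  have mVW : measurable (V `\` W : set (borel T)) by apply: measurableD.
  have pVW : (p (V `\` W) <= (e / 2)%:E)%E.
    apply: le_trans (epsilon_trick0 xpredT (ltW e20)).
    apply: (@le_trans _ _ (\sum_(0 <= n <oo) p (U n `\` F n))%E).
      apply: measure_sigma_subadditive.
      - by move=> n; apply: measurable_openD_closed; have [] := FU n.
      - exact: mVW.
      - move=> x [[n _ Unx] Wx]; exists n => //; split=> // Fnx.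
        by apply: Wx; exists n.
    by apply: lee_nneseries => // n _; have [_ _ _ _ /ltW] := FU n.
  have [n pn] : exists n, (p (W `\` G n) < (e / 2)%:E)%E.
    apply: finite_measure_nonincreasing_small e20.
    - by move=> n; apply: measurableD => //; exact: borel_closed.
    - move=> n m nm x [Wx Gx]; split => // Gnx; apply: Gx.
      exact: subset_bigsetU Gnx.
    - rewrite -subset0 => x DGx; have [[k _ Fkx] _] := DGx 0%N I.
      have [_] := DGx k.+1 I; apply.
      by rewrite /G big_ord_recr/=; right.
  exists (G n), V; split => //.
  + move=> x; rewrite /G -bigcup_mkord => -[k _ Fkx]; exists k => //.
    by have [_ _ FA _ _] := FU k; exact: FA.
  + move=> x [k _ Akx]; exists k => //.
    by have [_ _ _ AU _] := FU k; exact: AU.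
  + have -> : e%:E = ((e / 2)%:E + (e / 2)%:E)%E by rewrite -EFinD -splitr.
    apply: (@le_lt_trans _ _ (p (V `\` W) + p (W `\` G n))%E); last first.
      by apply: lee_ltD => //; exact: fin_num_measure.
    have mWG : measurable (W `\` G n : set (borel T)).
      by apply: measurableD => //; exact: borel_closed.
    apply: le_trans (measureU2 p mVW mWG).
    apply: le_measure; rewrite ?inE.
    * exact: measurable_openD_closed.
    * exact: measurableU.
    * by move=> x [Vx Gx]; have [Wx|Wx] := pselect (W x); [right|left].
Qed.

(** The total variation is a finite measure, and closed sets are compact. *)
Lemma charge_regular nu : compact [set: T] -> regular nu.
Proof.
move=> cT A mA e e0.
pose p : {finite_measure set (borel T) -> \bar R} :=
  measure_add (jordan_pos (hahnP nu)) (jordan_neg (hahnP nu)).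
have [F [U [cF oU FA AU pe]]] := finite_measure_approximable p mA e0.
exists F, U; split => //; first exact: subclosed_compact cF cT _.
by apply: le_lt_trans pe; rewrite /p le_eqVlt; apply/orP; left; apply/eqP/esym;
  exact: measure_addE.
Qed.

Lemma signed_measuresT : compact [set: T] -> @signed_measures R T = setT.
Proof. by move=> cT; apply/seteqP; split => // nu _; exact: charge_regular. Qed.

End borel_metric.

(** * Bilinearity and symmetry of the energy *)

(** Turns an error [e * m] into an error [e], also when the mass [m] is zero. *)
Lemma ler_shrink (R : realFieldType) (e m : R) : 0 < e -> 0 <= m ->
  e / (1 + m) * m <= e.
Proof.
move=> e0 m0; rewrite -mulrA ler_piMr ?(ltW e0)// mulrC ler_pdivrMr.
  by rewrite mul1r ler_wpDl.
by rewrite ltr_pwDl.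
Qed.

Section compact_metric.
Context (R : realType) (T : pmetricType R).
Hypothesis cT : compact [set: T].
Local Notation charges := (charge (borel T) R).
Implicit Types (nu : charges) (f : T -> R).

Lemma continuous_bounded_measurable f : continuous f ->
  bounded_measurable (f : borel T -> R).
Proof.
move=> cf; split; first exact: continuous_borel.
have : bounded_set (f @` setT).
  apply/compact_bounded/continuous_compact => //.
  exact: continuous_subspaceT.
move=> [M [_ hM]]; exists (M + 1) => x.
by apply: (hM (M + 1)); [rewrite ltrDl|exists x].
Qed.

(** Restricting each ball of a finite cover to the points that no earlier ball
    contains makes the cover disjoint. *)
Lemma small_partition (d : R) : 0 < d ->
  exists (n : nat) (z : 'I_n -> T) (A : 'I_n -> set (borel T)),
  [/\ forall i, measurable (A i), forall i, A i `<=` ball (z i) d &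
      forall x, exists2 i, A i x & forall j, A j x -> j = i].
Proof.
move=> d0; move: (cT); rewrite compact_cover => /(_ T setT (fun z => ball z d)).
case=> [z _|x _|D _ cD]; first exact: open_mball.
  by exists x => //; exact: ballxx.
pose s := in_tuple (finmap.enum_fset D).
pose z i := tnth s i.
pose B i := \bigcup_(k in [set k : 'I_(size s) | (k < i)%N]) ball (z k) d.
exists (size s), z, (fun i : 'I_(size s) => ball (z i) d `\` B i); split.
- move=> i; apply: measurableD; first exact: borel_ball.
  by apply: borel_open; apply: bigcup_open => k _; exact: open_mball.
- by move=> i x [].
- move=> x; have [y /= yD yx] := cD x I.
  have /tnthP[i0 yi0] : y \in s by [].
  pose P i := `[< ball (z i) d x >].
  have Pi0 : P i0 by apply/asboolP; rewrite /z -yi0.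
  case: (arg_minnP (fun i : 'I__ => i : nat) Pi0) => i /asboolP Pi mini.
  exists i.
    by split => // -[k /= ki /asboolP/mini]; rewrite leqNgt ki.
  move=> j [/asboolP Pj Bj]; apply/val_inj/eqP; rewrite eqn_leq mini// andbT.
  by rewrite leqNgt; apply/negP => ij; apply: Bj; exists i.
Qed.

(** The sum is the integral of the step function with value [c i] on [A i]. *)
Lemma cintegral_step nu f (e : R) n (A : 'I_n -> set (borel T))
    (c : 'I_n -> R) :
  bounded_measurable (f : borel T -> R) ->
  (forall i, measurable (A i)) ->
  (forall x, exists2 i, A i x & forall j, A j x -> j = i) ->
  (forall i x, A i x -> `|f x - c i| <= e) ->
  `|cintegral nu f - \sum_(i < n) fine (nu (A i)) * c i| <= e * total_mass nu.
Proof.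
move=> bf mA pA fc; pose g (x : borel T) := \sum_(i < n) c i * \1_(A i) x.
have bA i : bounded_measurable (\1_(A i) : borel T -> R).
  exact: bounded_measurable_indic.
have bcA i : bounded_measurable (fun x : borel T => c i * \1_(A i) x).
  exact: bounded_measurableZ.
have bg : bounded_measurable g by exact: bounded_measurable_sum.
have -> : \sum_(i < n) fine (nu (A i)) * c i = cintegral nu g.
  rewrite cintegral_sum//; apply: eq_bigr => i _.
  by rewrite cintegralZ// cintegral_indic// mulrC.
rewrite -cintegralB//; apply: cintegral_le; first exact: bounded_measurableB.
move=> x; have [i Aix iuniq] := pA x.
suff -> : g x = c i by exact: fc.
rewrite /g (bigD1 i)//= indicE mem_set// mulr1 big1 ?addr0// => j ji.
by rewrite indicE memNset ?mulr0// => /iuniq /eqP; rewrite (negbTE ji).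
Qed.

End compact_metric.

Section energy_theory.
Context (R : realType) (T : pmetricType R).
Hypothesis cT : compact [set: T].
Local Notation charges := (charge (borel T) R).
Implicit Types (mu nu : charges) (f : T -> R).
Variable K : T * T -> R.
Hypothesis kK : is_kernel K.

Lemma kernel_section_continuous x : continuous (fun y => K (x, y)).
Proof.
move=> y; apply: (@continuous_comp _ _ _ (fun y => (x, y)) K); last exact: kK.1.
by apply: cvg_pair; [exact: cvg_cst|exact: cvg_id].
Qed.

Lemma kernel_section_bm x : bounded_measurable (fun y : borel T => K (x, y)).
Proof.
exact: (continuous_bounded_measurable cT (@kernel_section_continuous x)).
Qed.

Definition small_oscillation (d e : R) f :=
  forall x x', ball x d x' -> `|f x - f x'| <= e.

Lemma small_oscillation_cvg f : (forall e, 0 < e -> exists2 d : R, 0 < d &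
  small_oscillation d e f) -> continuous f.
Proof.
move=> hf x; apply/cvgrPdist_le => e /hf[d d0 fd].
by near=> y; apply: fd; near: y; exact: nbhsx_ballx.
Unshelve. all: by end_near. Qed.

(** By compactness of the product, the radius that continuity provides at each
    point can be chosen once for all points. *)
Lemma kernel_uniform e : 0 < e -> exists2 d : R, 0 < d &
  forall y, small_oscillation d e (fun x => K (x, y)).
Proof.
move=> e0.
have /compact_near_coveringP cTT : compact [set: T * T].
  by rewrite -setXTT; exact: compact_setX.
have := cTT R 0^'+ (fun d z => forall x', ball z.1 d x' ->
  `|K z - K (x', z.2)| <= e) _.
case.
  move=> [x y] _.
  have e20 : 0 < e / 2 by rewrite divr_gt0.
  have /cvgrPdist_lt /(_ _ e20)[[U V] /= [Ux Vy] UV] := kK.1 (x, y).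
  have /nbhs_ballP[r /= r0 rU] := Ux.
  have r20 : 0 < r / 2 by rewrite divr_gt0.
  exists ((ball x (r / 2) `*` V), [set d | d <= r / 2]).
    split => /=; last exact: nbhs_right_le.
    by exists (ball x (r / 2), V) => //; split => //; exact: nbhsx_ballx.
  move=> [[x1 y1] d] /= [[xx1 Vy1] dr] x' x1x'.
  have Ux1 : U x1 by apply: rU; apply: le_ball xx1; lra.
  have Ux' : U x'.
    apply: rU; rewrite [r]splitr; apply: ball_triangle xx1 _.
    exact: le_ball x1x'.
  have := UV (x1, y1) (conj Ux1 Vy1); have := UV (x', y1) (conj Ux' Vy1).
  rewrite /= !ltr_norml !ler_norml => /andP[? ?] /andP[? ?].
  by apply/andP; split; lra.
move=> r /= r0 hr; exists (r / 2); first by rewrite divr_gt0.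
have r20 : 0 < r / 2 by rewrite divr_gt0.
move=> y x x' xx'; apply: (hr (r / 2) _ r20 (x, y) I x' xx').
by rewrite /ball/= sub0r normrN gtr0_norm//; lra.
Qed.

Lemma mutual_energyE mu nu :
  mutual_energy K mu nu = cintegral nu (potential K mu).
Proof.
rewrite /mutual_energy /potential; congr cintegral; apply/funext => y.
by congr cintegral; apply/funext => x; exact: kK.2.
Qed.

Lemma potential_oscillation d e nu : 0 <= e ->
  (forall y, small_oscillation d e (fun x => K (x, y))) ->
  small_oscillation d (e * total_mass nu) (potential K nu).
Proof.
move=> e0 Ke x x' xx'; rewrite /potential.
rewrite -cintegralB; [|exact: kernel_section_bm..].
apply: cintegral_le; last by move=> y; exact: Ke.
by apply: bounded_measurableB; exact: kernel_section_bm.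
Qed.

Lemma potential_continuous nu : continuous (potential K nu).
Proof.
apply: small_oscillation_cvg => e e0.
have m0 := total_mass_ge0 nu.
have e'0 : 0 < e / (1 + total_mass nu) by rewrite divr_gt0// ltr_pwDl.
have [d d0 hd] := kernel_uniform e'0; exists d => // x x' xx'.
have := potential_oscillation nu (ltW e'0) hd xx' => /le_trans; apply.
exact: ler_shrink.
Qed.

Lemma potential_bm nu : bounded_measurable (potential K nu : borel T -> R).
Proof.
exact: (continuous_bounded_measurable cT (@potential_continuous nu)).
Qed.

Lemma potential_cadd mu nu x :
  potential K (cadd mu nu) x = potential K mu x + potential K nu x.
Proof. by apply: cintegral_cadd; exact: kernel_section_bm. Qed.

Lemma potential_cscale c nu x :
  potential K (cscale c nu) x = c * potential K nu x.
Proof. by apply: cintegral_cscale; exact: kernel_section_bm. Qed.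

(** On a fine partition the inner integral is close to a finite sum of sections
    of the kernel, and for such a sum the interchange of the two integrals is
    linearity; this keeps product measures out of the argument. *)
Lemma mutual_energyC mu nu : mutual_energy K mu nu = mutual_energy K nu mu.
Proof.
rewrite !mutual_energyE.
pose m := total_mass mu * total_mass nu.
have m0 : 0 <= m by rewrite mulr_ge0// total_mass_ge0.
suff h e : 0 < e -> `|cintegral nu (potential K mu) -
    cintegral mu (potential K nu)| <= e * (2 * m).
  apply/eqP; rewrite -subr_eq0 -normr_le0; apply/ler_addgt0Pl => e e0.
  have m1 : 0 < 1 + 2 * m by rewrite ltr_pwDl// mulr_ge0.
  rewrite addr0; apply: le_trans (h (e / (1 + 2 * m)) _) _.
    by rewrite divr_gt0.
  by apply: ler_shrink => //; exact: mulr_ge0.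
move=> e0; have [d d0 hd] := kernel_uniform e0.
have [n [z [A [mA Az pA]]]] := small_partition cT d0.
pose S y := \sum_(i < n) fine (mu (A i)) * K (z i, y).
have bS : bounded_measurable (S : borel T -> R).
  by apply: bounded_measurable_sum => i; apply: bounded_measurableZ;
    exact: kernel_section_bm.
have close1 : `|cintegral nu (potential K mu) - cintegral nu S| <= e * m.
  rewrite -cintegralB//; last exact: potential_bm.
  rewrite /m mulrA; apply: cintegral_le.
    by apply: bounded_measurableB => //; exact: potential_bm.
  move=> y; apply: cintegral_step => //; first exact: kernel_section_bm.
  move=> i x Aix; rewrite [X in `|X - _|]kK.2 distrC; apply: hd.
  exact: Az Aix.
have SE : cintegral nu S = \sum_(i < n) fine (mu (A i)) * potential K nu (z i).
  rewrite cintegral_sum => [|i]; last first.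
    by apply: bounded_measurableZ; exact: kernel_section_bm.
  by apply: eq_bigr => i _; rewrite cintegralZ//; exact: kernel_section_bm.
have close2 : `|cintegral mu (potential K nu) - cintegral nu S| <= e * m.
  rewrite SE /m [total_mass mu * _]mulrC mulrA; apply: cintegral_step => //.
    exact: potential_bm.
  move=> i x Aix; rewrite distrC.
  exact: (potential_oscillation nu (ltW e0) hd (Az _ _ Aix)).
move: close1 close2; rewrite !ler_norml => /andP[? ?] /andP[? ?].
by apply/andP; split; lra.
Qed.

Lemma mutual_energyDl mu mu' nu : mutual_energy K (cadd mu mu') nu =
  mutual_energy K mu nu + mutual_energy K mu' nu.
Proof.
rewrite !mutual_energyE -cintegralD; [|exact: potential_bm..].
by congr cintegral; apply/funext => x; exact: potential_cadd.
Qed.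

Lemma mutual_energyZl c mu nu : mutual_energy K (cscale c mu) nu =
  c * mutual_energy K mu nu.
Proof.
rewrite !mutual_energyE -cintegralZ; last exact: potential_bm.
by congr cintegral; apply/funext => x; exact: potential_cscale.
Qed.

Lemma mutual_energyDr mu nu nu' : mutual_energy K mu (cadd nu nu') =
  mutual_energy K mu nu + mutual_energy K mu nu'.
Proof.
by rewrite mutual_energyC mutual_energyDl !(mutual_energyC _ mu).
Qed.

Lemma mutual_energyZr c mu nu : mutual_energy K mu (cscale c nu) =
  c * mutual_energy K mu nu.
Proof. by rewrite mutual_energyC mutual_energyZl mutual_energyC. Qed.

Lemma energyD mu nu : energy K (cadd mu nu) =
  energy K mu + 2 * mutual_energy K mu nu + energy K nu.
Proof.
rewrite /energy mutual_energyDl (mutual_energyDr mu) (mutual_energyDr nu).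
by rewrite (mutual_energyC nu mu) mulr2n mulrDl mul1r !addrA.
Qed.

Lemma energyZ c mu : energy K (cscale c mu) = c ^+ 2 * energy K mu.
Proof. by rewrite /energy mutual_energyZl mutual_energyZr mulrA. Qed.

Lemma energyDZ c mu nu : energy K (cadd mu (cscale c nu)) =
  energy K mu + 2 * c * mutual_energy K mu nu + c ^+ 2 * energy K nu.
Proof. by rewrite energyD energyZ mutual_energyZr; lra. Qed.

Lemma energy_mix t mu nu : energy K (mix t mu nu) = (1 - t) ^+ 2 * energy K mu +
  2 * ((1 - t) * t) * mutual_energy K mu nu + t ^+ 2 * energy K nu.
Proof.
by rewrite /mix energyD !energyZ mutual_energyZl mutual_energyZr; lra.
Qed.

Lemma eq_energy mu nu : (forall A, measurable A -> fine (mu A) = fine (nu A)) ->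
  energy K mu = energy K nu.
Proof.
move=> mn; rewrite /energy !mutual_energyE.
have -> : potential K mu = potential K nu.
  apply/funext => x; apply: eq_cintegral_charge => //.
  exact: kernel_section_bm.
by apply: eq_cintegral_charge => //; exact: potential_bm.
Qed.

End energy_theory.

(** * Combinations of charges and concentrated probabilities *)

Section charge_comb.
Context (R : realType) (T : pmetricType R).
Local Notation charges := (charge (borel T) R).
Implicit Types (nu : charges) (f : borel T -> R) (s : seq (R * charges)).

Definition charge_comb s : charges :=
  foldr (fun p (acc : charges) => cadd (cscale p.1 p.2) acc : charges)
    (czero : charges) s.

Lemma fine_charge_comb s A : measurable A ->
  fine (charge_comb s A) = \sum_(p <- s) p.1 * fine (p.2 A).
Proof.
move=> mA; elim: s => [|p s ih]; first by rewrite big_nil.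
by rewrite big_cons -ih /= fine_cadd// fine_cscale.
Qed.

Lemma cintegral_comb s f : bounded_measurable f ->
  cintegral (charge_comb s) f = \sum_(p <- s) p.1 * cintegral p.2 f.
Proof.
move=> bf; elim: s => [|p s ih].
  have /= -> := @cintegralE _ _ _ (charge_comb [::])
    (mzero : {finite_measure set _ -> \bar R}) mzero _ bf.
    by rewrite subrr big_nil.
  by move=> A mA /=; rewrite subr0.
by rewrite big_cons -ih /= cintegral_cadd// cintegral_cscale.
Qed.

End charge_comb.

Section charge_probability.
Context (R : realType) (T : pmetricType R).
Local Notation charges := (charge (borel T) R).
Implicit Types (nu : charges) (f : borel T -> R) (p : probability (borel T) R).

Lemma cintegral_of_probability p f : bounded_measurable f ->
  cintegral (of_probability p) f = \int[p]_x f x.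
Proof.
move=> bf; rewrite (cintegralE (p := p) (q := mzero) bf).
  by rewrite {2}/Rintegral integral_measure_zero/= subr0.
by move=> A mA /=; rewrite subr0.
Qed.

Lemma fine_of_probability p A : fine (of_probability p A) = fine (p A).
Proof. by []. Qed.

Lemma fine_probability_setT p : fine (p setT) = 1.
Proof. by rewrite probability_setT. Qed.

(** Normalizing does nothing here: it only repackages a nonnegative charge of
    total mass one as a probability, with [p0] as its default value. *)
Lemma nonnegative_charge_probability nu (p0 : probability (borel T) R) :
  (forall A, measurable A -> 0 <= fine (nu A)) ->
  fine (nu setT) = 1 ->
  exists p : probability (borel T) R,
    forall A, measurable A -> fine (p A) = fine (nu A).
Proof.
move=> nu0 nu1.
have nur0 E : (0 <= crestr0 nu measurableT E)%E.
  rewrite /crestr0; case: ifPn => // /set_mem mE.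
  by rewrite /crestr setIT -(fineK (charge_fin_num nu mE)) lee_fin nu0.
pose m := measure_of_charge (crestr0 nu measurableT) nur0.
have mE A : measurable A -> m A = nu A.
  by move=> mA; rewrite /m /measure_of_charge /crestr0 mem_set// /crestr setIT.
exists (mnormalize m p0) => A mA.
have mT : m setT = 1%E.
  by rewrite mE// -(fineK (charge_fin_num nu measurableT)) nu1.
transitivity (fine (m A * (fine 1%E)^-1%:E)); last by rewrite invr1 mule1 mE.
by rewrite -mT /= /mnormalize [X in X == 0%E]mT [X in X == +oo%E]mT onee_eq0.
Qed.

(** The common feature of a point mass at [z] and of the normalized restriction
    of a measure to a small ball around [z]: integration is almost evaluation at
    [z] for functions that vary little on the ball. *)
Definition concentrated (d : R) (z : T) nu := forall f e,
  bounded_measurable f -> (forall x, ball z d x -> `|f x - f z| <= e) ->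
  `|cintegral nu f - f z| <= e.

Lemma concentrated_probability p d z : fine (p (~` ball z d)) = 0 -> 0 < d ->
  concentrated d z (of_probability p).
Proof.
move=> pB d0 f e bf fe.
have bfz : bounded_measurable (fun x => f x - f z).
  by apply: bounded_measurableB => //; exact: bounded_measurable_cst.
have e0 : 0 <= e by apply: le_trans (fe z (ballxx _ d0)).
rewrite cintegral_of_probability//.
have -> : \int[p]_x f x - f z = \int[p]_x (f x - f z).
  rewrite RintegralB//; try exact: bounded_measurable_integrable.
    by rewrite Rintegral_cst// fine_probability_setT mulr1.
  by apply: bounded_measurable_integrable; exact: bounded_measurable_cst.
have [M fM] := bfz.2.
have M0 : 0 <= M by apply: le_trans (fM z).
have mC : measurable (~` ball z d : set (borel T)).
  by apply: measurableC; exact: borel_ball.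
pose g (x : borel T) := e + M * \1_(~` ball z d) x.
have b1 : bounded_measurable (fun x : borel T => M * \1_(~` ball z d) x).
  by apply: bounded_measurableZ; exact: bounded_measurable_indic.
have bg : bounded_measurable g.
  by apply: bounded_measurableD => //; exact: bounded_measurable_cst.
apply: le_trans (le_normr_Rintegral measurableT _) _.
  exact: bounded_measurable_integrable.
apply: (@le_trans _ _ (\int[p]_x g x)).
  apply: le_Rintegral => //.
  - by apply: integrable_norm; exact: bounded_measurable_integrable.
  - exact: bounded_measurable_integrable.
  - move=> x _; rewrite /g indicE; have [Bx|Bx] := pselect (ball z d x).
      by rewrite memNset ?mulr0 ?addr0 ?fe//; exact.
    by rewrite mem_set// mulr1 (le_trans (fM x))// ler_wpDl.
rewrite -cintegral_of_probability// /g cintegralD//; last first.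
  exact: bounded_measurable_cst.
rewrite cintegral_cst cintegralZ ?cintegral_indic//; last first.
  exact: bounded_measurable_indic.
by rewrite !fine_of_probability pB fine_probability_setT; lra.
Qed.

Lemma concentrated_dirac d z : 0 < d ->
  concentrated d z (of_probability (dirac (z : borel T))).
Proof.
move=> d0; apply: concentrated_probability => //.
transitivity (fine (\d_(z : borel T) (~` ball z d) : \bar R)) => //.
by rewrite diracE memNset//; apply; exact: ballxx.
Qed.

Variable mu : probability (borel T) R.
Hypothesis supp_mu : supp mu = setT.

(** The last argument of [mnormalize] is a default value, used only when the
    ball is null; full support excludes that. *)
Definition ball_average d z : probability (borel T) R :=
  mnormalize (mrestr mu (borel_ball z d)) mu.

Lemma mu_ball_gt0 d z : 0 < d -> 0 < fine (mu (ball z d)).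
Proof.
move=> d0; have : supp mu z by rewrite supp_mu.
move=> /(_ _ (@open_mball R T z d) (ballxx _ d0)) mB.
by rewrite fine_gt0// mB/= -ge0_fin_numE// fin_num_measure//; exact: borel_ball.
Qed.

Lemma fine_ball_average d z A : 0 < d -> measurable A ->
  fine (ball_average d z A) = fine (mu (A `&` ball z d)) / fine (mu (ball z d)).
Proof.
move=> d0 mA; have m0 := mu_ball_gt0 z d0.
have mB : measurable (ball z d : set (borel T)) by exact: borel_ball.
have mT : mrestr mu (borel_ball z d) setT = mu (ball z d).
  by rewrite /mrestr setTI.
transitivity (fine (mrestr mu (borel_ball z d) A *
    (fine (mrestr mu (borel_ball z d) setT))^-1%:E)).
  congr fine; rewrite /ball_average /= /mnormalize.
  by case: ifPn => // /orP[]/eqP m; rewrite -mT m ltxx in m0.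
rewrite mT fineM// /mrestr fin_num_measure//; exact: measurableI.
Qed.

Lemma concentrated_ball_average d z : 0 < d ->
  concentrated d z (of_probability (ball_average d z)).
Proof.
move=> d0; apply: concentrated_probability => //.
rewrite fine_ball_average//; last by apply: measurableC; exact: borel_ball.
by rewrite setICl measure0 mul0r.
Qed.

Lemma ball_average_le d z A : 0 < d -> measurable A ->
  fine (ball_average d z A) <= (fine (mu (ball z d)))^-1 * fine (mu A).
Proof.
move=> d0 mA; rewrite fine_ball_average// mulrC ler_wpM2l//.
  by rewrite invr_ge0 ltW// mu_ball_gt0.
have mB : measurable (ball z d : set (borel T)) by exact: borel_ball.
have mAB : measurable (A `&` ball z d) by exact: measurableI.
by rewrite fine_le// ?fin_num_measure// le_measure// inE.
Qed.

End charge_probability.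

(** * Approximation of the energy by finite combinations *)

Definition quadratic_form (R : realType) (T : Type) (K : T * T -> R)
    (s : seq (R * T)) : R :=
  \sum_(p <- s) \sum_(q <- s) p.1 * q.1 * K (p.2, q.2).

Section discretization.
Context (R : realType) (T : pmetricType R).
Hypothesis cT : compact [set: T].
Local Notation charges := (charge (borel T) R).
Implicit Types (mu nu : charges) (f : T -> R).
Variable K : T * T -> R.
Hypothesis kK : is_kernel K.

Definition spread (b : T -> charges) (s : seq (R * T)) : charges :=
  charge_comb [seq (p.1, b p.2) | p <- s].

Lemma cintegral_spread b s (f : borel T -> R) : bounded_measurable f ->
  cintegral (spread b s) f = \sum_(p <- s) p.1 * cintegral (b p.2) f.
Proof. by move=> bf; rewrite cintegral_comb// big_map. Qed.

Lemma fine_spread b s A : measurable A ->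
  fine (spread b s A) = \sum_(p <- s) p.1 * fine (b p.2 A).
Proof. by move=> mA; rewrite fine_charge_comb// big_map. Qed.

(** Let [nu'] be obtained by moving the mass of each cell of a fine partition to
    the concentrated charge at its centre. A function that oscillates by at most
    [a] at that scale has almost the same integral against [nu] and [nu']; this
    applies to the potentials of both charges, and symmetry links the mixed
    terms. The constant 12 collects the errors of replacing first one and then
    the other copy of [nu]: the potential of the replacement oscillates at most
    five times as much as allowed for that of [nu]. *)
Lemma energy_approx nu (e : R) : 0 < e -> exists2 d : R, 0 < d &
  forall b : T -> charges, (forall z, concentrated d z (b z)) ->
  exists s : seq (R * T), \sum_(p <- s) p.1 = fine (nu setT) /\
    `|energy K nu - energy K (spread b s)| <= e.
Proof.
move=> e0; pose M := total_mass nu; have M0 : 0 <= M := total_mass_ge0 nu.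
have MM0 : 0 <= 12 * M ^+ 2 by rewrite mulr_ge0// sqr_ge0.
pose c := e / (1 + 12 * M ^+ 2).
have c0 : 0 < c by rewrite divr_gt0// ltr_pwDl.
have [d d0 hd] := kernel_uniform cT kK c0.
have [n [z [A [mA Az pA]]]] := small_partition cT d0.
exists d => // b cb; pose s := [seq (fine (nu (A i)), z i) | i <- enum 'I_n].
exists s.
have close f (a : R) : bounded_measurable (f : borel T -> R) ->
    small_oscillation d a f ->
    `|cintegral nu f - cintegral (spread b s) f| <= 2 * a * M.
  move=> bf fa; rewrite cintegral_spread// /s big_map big_enum/=.
  apply: cintegral_step => // i x Aix.
  have h1 : `|f (z i) - f x| <= a by apply: fa; exact: Az Aix.
  have h2 : `|cintegral (b (z i)) f - f (z i)| <= a.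
    by apply: cb => // y zy; rewrite distrC; exact: fa.
  move: h1 h2; rewrite !ler_norml => /andP[? ?] /andP[? ?].
  by apply/andP; split; lra.
split.
  rewrite /s big_map big_enum/=.
  have b1 : @bounded_measurable _ (borel T) R (fun=> 1).
    exact: bounded_measurable_cst.
  have := @cintegral_step _ _ nu (fun=> 1) 0 n A (fun=> 1) b1 mA pA.
  rewrite cintegral_cst mul1r mul0r => H.
  have /eqP : fine (nu setT) - \sum_(i < n) fine (nu (A i)) * 1 == 0.
    by rewrite -normr_le0; apply: H => i x _; rewrite subrr normr0.
  by move=> /subr0_eq ->; apply: eq_bigr => i _; rewrite mulr1.
pose nu' := spread b s; pose U := potential K nu; pose U' := potential K nu'.
have UU' y : `|U y - U' y| <= 2 * c * M.
  apply: close; first exact: kernel_section_bm.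
  by move=> x x' xx'; rewrite !(kK.2 y); exact: hd.
have Uosc : small_oscillation d (c * M) U.
  by apply: (potential_oscillation cT kK nu) => //; exact: ltW.
have U'osc : small_oscillation d (5 * c * M) U'.
  move=> x x' xx'; move: (Uosc _ _ xx') (UU' x) (UU' x').
  rewrite !ler_norml => /andP[? ?] /andP[? ?] /andP[? ?].
  by apply/andP; split; lra.
have bU : bounded_measurable (U : borel T -> R) by exact: potential_bm.
have bU' : bounded_measurable (U' : borel T -> R) by exact: potential_bm.
have h1 := close _ _ bU Uosc.
have h2 := close _ _ bU' U'osc.
have sym : cintegral nu' U = cintegral nu U'.
  by rewrite -(mutual_energyE kK) (mutual_energyC cT kK) (mutual_energyE kK).
(* h1 compares I(nu, nu) with I(nu, nu') and h2 compares I(nu', nu) with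
   I(nu', nu') *)
rewrite /energy !(mutual_energyE kK) -/nu' -/U -/U'.
apply: (@le_trans _ _ (c * (12 * M ^+ 2))); last exact: ler_shrink.
rewrite -/nu' sym in h1.
apply: le_trans (ler_distD (cintegral nu U') _ _) _.
apply: le_trans (lerD h1 h2) _; rewrite le_eqVlt; apply/orP; left; apply/eqP.
by ring.
Qed.

Lemma is_kernelD (C : R) : is_kernel (fun z => K z + C).
Proof.
split; last by move=> x y; rewrite kK.2.
by move=> z; apply: cvgD; [exact: kK.1|exact: cvg_cst].
Qed.

Lemma potential_addC (C : R) nu x :
  potential (fun z => K z + C) nu x = potential K nu x + C * fine (nu setT).
Proof.
rewrite /potential cintegralD ?cintegral_cst//; first exact: kernel_section_bm.
exact: bounded_measurable_cst.
Qed.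

Lemma energy_addC (C : R) nu :
  energy (fun z => K z + C) nu = energy K nu + C * fine (nu setT) ^+ 2.
Proof.
rewrite /energy (mutual_energyE (is_kernelD C)) (mutual_energyE kK).
have -> : potential (fun z => K z + C) nu =
    fun x => potential K nu x + C * fine (nu setT).
  by apply/funext => x; exact: potential_addC.
rewrite cintegralD ?cintegral_cst//; [by rewrite expr2 mulrA|..].
  exact: potential_bm.
exact: bounded_measurable_cst.
Qed.

Definition dirac_charge (z : T) : charges :=
  of_probability (dirac (z : borel T)).

Lemma cintegral_dirac z (f : borel T -> R) : bounded_measurable f ->
  cintegral (dirac_charge z) f = f z.
Proof.
move=> bf; rewrite cintegral_of_probability// /Rintegral integral_dirac//.
  by rewrite diracT mul1e.
by apply/measurable_EFinP; exact: bf.1.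
Qed.

Lemma energy_dirac s : energy K (spread dirac_charge s) = quadratic_form K s.
Proof.
rewrite /energy (mutual_energyE kK) cintegral_spread; last exact: potential_bm.
apply: eq_bigr => p _; rewrite cintegral_dirac; last exact: potential_bm.
rewrite /potential cintegral_spread; last exact: kernel_section_bm.
rewrite mulr_sumr; apply: eq_bigr => q _.
by rewrite cintegral_dirac ?mulrA//; exact: kernel_section_bm.
Qed.

End discretization.

(** * Invariant measures *)

Section invariant.
Context (R : realType) (T : pmetricType R).
Hypothesis cT : compact [set: T].
Local Notation charges := (charge (borel T) R).
Implicit Types (nu : charges).
Variables (K : T * T -> R) (mu : probability (borel T) R).
Hypothesis kK : is_kernel K.
Hypothesis invK : invariant_measure K (of_probability mu).
Local Notation m := (of_probability mu).

Lemma neutralP nu : neutral_measures nu <-> fine (nu setT) = 0.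
Proof.
split=> [[_ ->]//|nu0]; split; first by rewrite signed_measuresT.
by rewrite -(fineK (charge_fin_num nu measurableT)) nu0.
Qed.

Lemma mutual_energy_invariant nu :
  mutual_energy K m nu = energy K m * fine (nu setT).
Proof.
rewrite (mutual_energyE kK) -cintegral_cst; congr cintegral.
by apply/funext => x; exact: invK.
Qed.

Lemma energy_invariantD (t : R) nu : energy K (cadd nu (cscale t m)) =
  energy K nu + (2 * t * fine (nu setT) + t ^+ 2) * energy K m.
Proof.
rewrite (energyDZ cT kK) (mutual_energyC cT kK) mutual_energy_invariant.
by ring.
Qed.

(** Subtracting [nu T] times the invariant measure makes [nu] neutral, and by
    invariance it lowers the energy of [nu] by exactly what the constant kernel
    [energy K m] assigns to [nu]. *)
Lemma conditionally_positive_shift : conditionally_positive_definite K ->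
  positive_definite (fun z => K z - energy K m).
Proof.
move=> cpd nu _; rewrite (energy_addC cT kK).
pose nu0 : charges := cadd nu (cscale (- fine (nu setT)) m).
have : neutral_measures nu0.
  apply/neutralP; rewrite fine_cadd// fine_cscale// fine_of_probability.
  by rewrite fine_probability_setT mulr1 subrr.
move=> /cpd; rewrite energy_invariantD.
by congr (_ <= _); ring.
Qed.

Lemma positive_mod_constant_conditionally :
  positive_definite_mod_constant K -> conditionally_positive_definite K.
Proof.
move=> [C pC] nu /neutralP nu0.
have /pC : signed_measures nu by rewrite signed_measuresT.
by rewrite (energy_addC cT kK) nu0 expr0n mulr0 addr0.
Qed.

(** A small multiple of a neutral charge dominated by [mu] may be added to [mu]
    without leaving the probabilities; by invariance the energy then changes
    exactly by the energy of the perturbation. *)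
Lemma dominated_neutral_energy_ge0 nu (C : R) :
  global_minimizer_over (@probabilities R T) K m -> 0 <= C ->
  (forall A, measurable A -> `|fine (nu A)| <= C * fine (mu A)) ->
  fine (nu setT) = 0 -> 0 <= energy K nu.
Proof.
move=> [_ mini] C0 nuC nu0; pose t := (1 + C)^-1.
have C1 : 0 < 1 + C by rewrite ltr_pwDl.
have t0 : 0 < t by rewrite invr_gt0.
have tC : t * C <= 1 by rewrite mulrC ler_pdivrMr// mul1r ler_wpDl.
pose nu1 : charges := cadd m (cscale t nu).
have nu1E A : measurable A -> fine (nu1 A) = fine (mu A) + t * fine (nu A).
  by move=> mA; rewrite fine_cadd// fine_cscale.
have nu1_ge0 A : measurable A -> 0 <= fine (nu1 A).
  move=> mA; rewrite nu1E//; move: (nuC A mA); rewrite ler_norml => /andP[h _].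
  have mA0 : 0 <= fine (mu A) by rewrite fine_ge0.
  have h1 : t * (- (C * fine (mu A))) <= t * fine (nu A) by rewrite ler_pM2l.
  have h2 : t * C * fine (mu A) <= 1 * fine (mu A) by rewrite ler_wpM2r.
  by lra.
have nu1T : fine (nu1 setT) = 1.
  by rewrite nu1E// nu0 mulr0 addr0 fine_probability_setT.
have [p pE] := nonnegative_charge_probability mu nu1_ge0 nu1T.
have : energy K m <= energy K (of_probability p) by apply: mini; exists p.
rewrite (eq_energy cT kK (mu := of_probability p) (nu := nu1)); last first.
  exact: pE.
rewrite (energyDZ cT kK) mutual_energy_invariant nu0 !mulr0 addr0 lerDl.
by rewrite pmulr_rge0// exprn_gt0.
Qed.

(** The normalized restriction of [mu] to a ball has a bounded density with
    respect to [mu], hence so has a finite combination of such restrictions. *)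
Lemma spread_ball_average_dominated (d : R) s : supp mu = setT -> 0 < d ->
  exists2 C : R, 0 <= C & forall A, measurable A ->
    `|fine (spread (fun z => of_probability (ball_average mu d z)) s A)| <=
    C * fine (mu A).
Proof.
move=> smu d0.
exists (\sum_(p <- s) `|p.1| * (fine (mu (ball p.2 d)))^-1).
  apply: sumr_ge0 => p _; rewrite mulr_ge0// invr_ge0 ltW//.
  exact: mu_ball_gt0.
move=> A mA; rewrite fine_spread// mulr_suml.
apply: le_trans (ler_norm_sum _ _ _) _; apply: ler_sum => p _.
rewrite normrM -mulrA ler_wpM2l// ger0_norm; last by rewrite fine_ge0.
exact: ball_average_le.
Qed.

(** Full support makes every ball of positive measure, so that [mu] can be
    averaged over it. *)
Lemma global_minimizer_conditionally : supp mu = setT ->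
  global_minimizer_over (@probabilities R T) K m ->
  conditionally_positive_definite K.
Proof.
move=> smu mini nu /neutralP nu0; apply/ler_addgt0Pr => e e0.
have [d d0 /(_ (fun z => of_probability (ball_average mu d z)))] :=
  energy_approx cT kK nu e0.
case=> [z|s [s0 se]]; first exact: concentrated_ball_average.
have [C C0 hC] := spread_ball_average_dominated s smu d0.
have := dominated_neutral_energy_ge0 mini C0 hC.
rewrite fine_spread//; under eq_bigr do rewrite fine_of_probability
  fine_probability_setT mulr1.
move=> /(_ (etrans s0 nu0)) h; move: se; rewrite ler_norml => /andP[se _].
by lra.
Qed.

End invariant.

(** * From an expansion to conditional positivity *)

Lemma uniform_cvgnP (R : realType) (X : choiceType) (u : nat -> X -> R)
    (f : X -> R) :
  {uniform, u @ \oo --> f} <-> forall e : R, 0 < e ->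
    \forall n \near \oo, forall x, `|f x - u n x| < e.
Proof.
split=> [uf e e0|uf P /uniform_nbhs[E [entE EP]]].
  apply: (uf [set h | forall x, `|f x - h x| < e]); apply/uniform_nbhs.
  exists [set xy | ball xy.1 e xy.2]; split.
    exact: (entourage_ball _ (PosNum e0)).
  by move=> h fh x; exact: fh.
have [e /= e0 eE] : exists2 e : R, 0 < e & [set xy | ball xy.1 e xy.2] `<=` E.
  by move: entE; rewrite -entourage_ballE => -[e e0 eE]; exists e.
near=> n; apply: EP => x _; apply: eE => /=.
by move: x; near: n; exact: uf.
Unshelve. all: by end_near. Qed.

Section quadratic.
Context (R : realType) (T : Type).
Implicit Types (K : T * T -> R) (s : seq (R * T)).

Lemma quadratic_form_rank1 (phi : T -> R) s :
  quadratic_form (fun z => phi z.1 * phi z.2) s =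
  (\sum_(p <- s) p.1 * phi p.2) ^+ 2.
Proof.
rewrite /quadratic_form expr2 mulr_suml; apply: eq_bigr => p _.
by rewrite mulr_sumr; apply: eq_bigr => q _; rewrite mulrACA.
Qed.

Lemma quadratic_formZ K (a : R) s :
  quadratic_form (fun z => a * K z) s = a * quadratic_form K s.
Proof.
rewrite /quadratic_form mulr_sumr; apply: eq_bigr => p _.
by rewrite mulr_sumr; apply: eq_bigr => q _; rewrite mulrCA.
Qed.

Lemma quadratic_formD K K' s : quadratic_form (fun z => K z + K' z) s =
  quadratic_form K s + quadratic_form K' s.
Proof.
rewrite /quadratic_form -big_split/=; apply: eq_bigr => p _.
by rewrite -big_split/=; apply: eq_bigr => q _; rewrite mulrDr.
Qed.

Lemma quadratic_form0 s : quadratic_form (fun=> 0 : R) s = 0.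
Proof.
rewrite /quadratic_form; under eq_bigr do under eq_bigr do rewrite mulr0.
by rewrite !big1.
Qed.

Lemma quadratic_form_sum (u : nat -> T * T -> R) n s :
  quadratic_form (fun z => \sum_(0 <= j < n) u j z) s =
  \sum_(0 <= j < n) quadratic_form (u j) s.
Proof.
elim: n => [|n ih].
  by under eq_fun do rewrite big_nil; rewrite quadratic_form0 big_nil.
under eq_fun do rewrite big_nat_recr//=.
by rewrite big_nat_recr//= -ih -quadratic_formD.
Qed.

Lemma quadratic_form_cst (a : R) s :
  quadratic_form (fun=> a) s = a * (\sum_(p <- s) p.1) ^+ 2.
Proof.
have := quadratic_form_rank1 (fun=> 1) s; under eq_bigr do rewrite mulr1.
by move=> <-; rewrite -quadratic_formZ; congr quadratic_form; apply/funext=> z;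
  rewrite !mulr1.
Qed.

Lemma quadratic_form_cvg (u : nat -> T * T -> R) K s :
  (forall z, u ^~ z @ \oo --> K z) ->
  (fun n => quadratic_form (u n) s) @ \oo --> quadratic_form K s.
Proof.
move=> uK; apply: cvg_big => [|p _]; first exact: add_continuous.
apply: cvg_big => [|q _]; first exact: add_continuous.
by apply: cvgM; [exact: cvg_cst|exact: uK].
Qed.

End quadratic.

Section expansion_conditionally.
Context (R : realType) (T : pmetricType R).
Hypothesis cT : compact [set: T].
Variables (K : T * T -> R) (mu : probability (borel T) R).
Hypothesis kK : is_kernel K.

(** The functions of the expansion may fail to be measurable, so the terms
    cannot be integrated against a charge. On a neutral combination of point
    masses, however, the constant term contributes zero and every other term a
    nonnegative multiple of a square, and such combinations approximate the
    energy of any neutral charge. *)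
Lemma expansion_conditionally : has_expansion mu K ->
  conditionally_positive_definite K.
Proof.
move=> [lambda [phi /= [cvgK _ [c phi0] lambda0]]] nu [_ nu0].
apply/ler_addgt0Pr => e e0.
have [d d0 /(_ (@dirac_charge R T))] := energy_approx cT kK nu e0.
case=> [z|s [s0 se]]; first exact: concentrated_dirac.
have {nu0}s0 : \sum_(p <- s) p.1 = 0 by rewrite s0 nu0.
suff : 0 <= energy K (spread (@dirac_charge R T) s).
  by move: se; rewrite ler_norml => /andP[? _] ?; lra.
rewrite (energy_dirac cT kK).
set u := expansion_term mu lambda phi in cvgK.
have uK z : (fun n => \sum_(0 <= j < n) u j z) @ \oo --> K z.
  apply/cvgrPdist_lt => e1 e10.
  near=> n; move: (z); near: n; exact: (uniform_cvgnP _ _).1 cvgK _ e10.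
have : (fun n => quadratic_form (fun z => \sum_(0 <= j < n) u j z) s) @ \oo -->
    quadratic_form K s.
  exact: quadratic_form_cvg.
move=> /cvgr_to_ge; apply; near=> n.
rewrite quadratic_form_sum; apply: sumr_ge0 => -[_|j _].
  suff [a ->] : exists a : R, u 0%N = fun=> a.
    by rewrite quadratic_form_cst s0 expr0n mulr0.
  have [h|/negbTE h] := boolP (0%N%:R%:E < L2_dim mu)%E.
    exists (lambda 0%N * c * c); apply/funext => z.
    by rewrite /u /expansion_term h !phi0.
  by exists 0; apply/funext => z; rewrite /u /expansion_term h.
have [h|/negbTE h] := boolP (j.+1%:R%:E < L2_dim mu)%E; last first.
  have -> : u j.+1 = fun=> 0 by apply/funext => z; rewrite /u /expansion_term h.
  by rewrite quadratic_form0.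
have -> : u j.+1 = fun z => lambda j.+1 * (phi j.+1 z.1 * phi j.+1 z.2).
  by apply/funext => z; rewrite /u /expansion_term h mulrA.
rewrite quadratic_formZ quadratic_form_rank1 mulr_ge0 ?sqr_ge0//.
exact: lambda0.
Unshelve. all: by end_near. Qed.

End expansion_conditionally.

(** * Lower bounds on the dimension of L^2 *)

Section L2_dimension.
Context (R : realType) (T : pmetricType R).
Variable mu : probability (borel T) R.
Hypothesis supp_mu : supp mu = setT.

Lemma Lfun_indic (A : set (borel T)) : measurable A ->
  (\1_A : borel T -> R) \in Lfun mu 2%:E.
Proof.
move=> mA; rewrite inE/=; apply/andP; split; rewrite inE/=.
  exact: measurable_indic.
rewrite /finite_norm unlock poweR_lty//.
under eq_integral => x _ /=.
  rewrite (_ : `|\1_A x| `^ 2 = \1_A x); first over.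
  rewrite indicE; case: (x \in A); rewrite ?normr1 ?normr0 ?powR1//.
  by rewrite powR0//; exact: lt0r_neq0.
by rewrite integral_indic// setIT -ge0_fin_numE// fin_num_measure.
Qed.

Lemma separated_balls n (z : 'I_n -> T) : injective z ->
  exists2 d : R, 0 < d &
    forall i j x, ball (z i) d x -> ball (z j) d x -> i = j.
Proof.
move=> zI.
have : \forall d \near 0^'+, forall i j : 'I_n,
    i != j -> d <= mdist (z i) (z j) / 2.
  apply: filter_forall => i; apply: filter_forall => j.
  have [_|ij] := eqVneq i j; first by near=> d.
  have dij : 0 < mdist (z i) (z j) / 2.
    by rewrite divr_gt0// mdist_gt0; apply: contra ij => /eqP/zI ->.
  by near=> d => _; near: d; exact: nbhs_right_le.
move=> h; have [d [d0 hd]] : exists d : R, 0 < d /\ forall i j : 'I_n,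
    i != j -> d <= mdist (z i) (z j) / 2.
  have [d] : exists d : R, 0 < d /\ _ :=
    filter_ex (filterI (nbhs_right_gt (0:R)) h).
  by exists d.
exists d => // i j x; rewrite !ballEmdist/= => ix jx.
apply/eqP/negPn/negP => /hd; have := metric_triangle (z i) x (z j).
by rewrite (metric_sym x); lra.
Unshelve. all: by end_near. Qed.

(** Indicators of disjoint balls around distinct points are independent modulo
    null sets, because no ball is null. *)
Lemma L2_dim_ge n (z : 'I_n -> T) : injective z -> (n%:R%:E <= L2_dim mu)%E.
Proof.
move=> zI; have [d d0 zd] := separated_balls zI.
apply: ereal_sup_ubound; exists n => //=.
have mB i : measurable (ball (z i) d : set (borel T)) by exact: borel_ball.
pose f i : L2fun mu := Lfun_Sub (@lee1n R 2) (Lfun_indic (mB i)).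
exists f => c ceq0 i.
have evalE x : (\sum_(i < n) c i *: f i : L2fun mu) x =
    \sum_(i < n) c i * \1_(ball (z i) d) x.
  by rewrite (big_morph (fun g : L2fun mu => g x) (id1 := 0) (op1 := +%R)).
apply: contrapT => ci0; have /= := mu_ball_gt0 supp_mu (z i) d0.
suff -> : mu (ball (z i) d) = 0%E by rewrite ltxx.
move: ceq0 => [N [mN N0 cN]]; apply/eqP.
rewrite -measure_le0 -N0; apply: le_measure; rewrite ?inE//.
move=> x ix; apply: cN => /= /(_ I); rewrite evalE (bigD1 i)//=.
rewrite indicE mem_set// mulr1 big1 ?addr0// => j ji.
rewrite indicE memNset ?mulr0// => jx.
by move: ji; rewrite (zd _ _ _ ix jx) eqxx.
Qed.

End L2_dimension.

(** * Schur complements of semidefinite kernels *)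

Section schur.
Context (R : realType) (T : Type).
Implicit Types (K : T * T -> R) (p : T).

Definition semidefinite K :=
  (forall x y, K (x, y) = K (y, x)) /\ forall s, 0 <= quadratic_form K s.

(** With the convention [a / 0 = 0] this is [K] itself when [K (p, p) = 0]. *)
Definition schur p K : T * T -> R :=
  fun z => K z - K (z.1, p) * K (p, z.2) / K (p, p).

Lemma quadratic_form_cons K a x s : (forall x y, K (x, y) = K (y, x)) ->
  quadratic_form K ((a, x) :: s) = a ^+ 2 * K (x, x) +
    2 * a * (\sum_(q <- s) q.1 * K (x, q.2)) + quadratic_form K s.
Proof.
move=> sK; rewrite /quadratic_form big_cons/= big_cons/=.
under [X in _ + X = _]eq_bigr do rewrite big_cons/=.
rewrite big_split/=.
have -> : \sum_(q <- s) a * q.1 * K (x, q.2) =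
    a * \sum_(q <- s) q.1 * K (x, q.2).
  by rewrite mulr_sumr; apply: eq_bigr => q _; rewrite mulrA.
have -> : \sum_(q <- s) q.1 * a * K (q.2, x) =
    a * \sum_(q <- s) q.1 * K (x, q.2).
  by rewrite mulr_sumr; apply: eq_bigr => q _; rewrite sK mulrAC mulrC.
by ring.
Qed.

Lemma semidefinite_diag K x : semidefinite K -> 0 <= K (x, x).
Proof.
move=> [sK pK]; have := pK [:: (1, x)].
rewrite quadratic_form_cons// /quadratic_form !big_nil.
by rewrite mulr0 expr1n mul1r !addr0.
Qed.

(** The squared distance of the images of [x] and [y] in the Hilbert space that
    the semidefinite kernel [K] defines. *)
Definition sqdist K x y := K (x, x) - 2 * K (x, y) + K (y, y).

Lemma semidefinite_sqdist K x y : semidefinite K -> 0 <= sqdist K x y.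
Proof.
move=> [sK pK]; have := pK [:: (1, x); (-1, y)].
rewrite !quadratic_form_cons// /quadratic_form !big_cons !big_nil/= /sqdist.
by move=> h; lra.
Qed.

Lemma semidefinite_norm K x y : semidefinite K ->
  `|K (x, y)| <= (K (x, x) + K (y, y)) / 2.
Proof.
move=> sdK; have := semidefinite_sqdist x y sdK.
move: sdK => [sK pK]; have := pK [:: (1, x); (1, y)].
rewrite !quadratic_form_cons// /quadratic_form !big_cons !big_nil/= /sqdist.
by move=> h1 h2; rewrite ler_norml; apply/andP; split; lra.
Qed.

(** Minimizing the quadratic form over the weight at [p] completes the square
    and leaves the form of the Schur complement. *)
Lemma semidefinite_schur p K : semidefinite K -> semidefinite (schur p K).
Proof.
move=> sdK; have [sK pK] := sdK; split=> [x y|s].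
  by rewrite /schur/= sK (sK x p) (sK p y); congr (_ - _ / _); rewrite mulrC.
pose a := K (p, p); pose l := \sum_(q <- s) q.1 * K (p, q.2).
have -> : schur p K = fun z => K z + - a^-1 * (K (p, z.1) * K (p, z.2)).
  by apply/funext => -[x y]; rewrite /schur/= (sK x p) mulNr (mulrC a^-1).
rewrite quadratic_formD quadratic_formZ.
rewrite (quadratic_form_rank1 (fun x => K (p, x))) -/l.
have [a0|a0] := eqVneq a 0.
  by rewrite a0 invr0 oppr0 mul0r addr0.
(* - l / a is the weight at p that minimizes the form *)
have := pK ((- (l / a), p) :: s).
rewrite quadratic_form_cons// -/a -/l.
suff -> : (- (l / a)) ^+ 2 * a + 2 * (- (l / a)) * l = - a^-1 * l ^+ 2.
  by rewrite addrC.
by field.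
Qed.

(** Passing to the Schur complement is an orthogonal projection, which contracts
    distances. *)
Lemma sqdist_schur p K x y : semidefinite K ->
  sqdist (schur p K) x y <= sqdist K x y.
Proof.
move=> sdK; have [sK pK] := sdK.
have -> : sqdist (schur p K) x y =
    sqdist K x y - (K (p, x) - K (p, y)) ^+ 2 / K (p, p).
  by rewrite /sqdist /schur/= (sK x p) (sK y p); ring.
by rewrite gerBl divr_ge0// ?sqr_ge0//; exact: semidefinite_diag.
Qed.

Lemma schur_diag_le p K x : semidefinite K -> schur p K (x, x) <= K (x, x).
Proof.
move=> sdK; rewrite /schur/= gerBl (sdK.1 x p) divr_ge0//.
  by rewrite -expr2 sqr_ge0.
exact: semidefinite_diag.
Qed.

End schur.

(** * Pivoted Cholesky expansion *)

Section pivoted_cholesky.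
Context (R : realType) (T : pmetricType R).
Hypothesis cT : compact [set: T].
Variables (H : T * T -> R) (mu : probability (borel T) R).
Hypothesis kH : is_kernel H.
Hypothesis sdH : semidefinite H.
Hypothesis supp_mu : supp mu = setT.
Hypothesis nullH : forall x,
  cintegral (of_probability mu) (fun y => H (x, y)) = 0.

(** A point where the diagonal is within a factor two of its supremum: such a
    point exists for every bounded diagonal, and the factor does no harm to the
    convergence. For the remainders below the default value [point] is never
    reached. *)
Definition pivot (K : T * T -> R) : T :=
  xget point [set x | forall y, K (y, y) <= 2 * K (x, x)].

Fixpoint remainder n : T * T -> R :=
  if n is n'.+1 then schur (pivot (remainder n')) (remainder n') else H.

Definition pivots n : T := pivot (remainder n).

Definition pivot_value n : R := remainder n (pivots n, pivots n).

Lemma remainderS n z : remainder n.+1 z = remainder n z -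
  remainder n (z.1, pivots n) * remainder n (pivots n, z.2) / pivot_value n.
Proof. by []. Qed.

Lemma semidefinite_remainder n : semidefinite (remainder n).
Proof. by elim: n => [//|n ih]; exact: semidefinite_schur. Qed.

Lemma remainder_diag_le n k x : (k <= n)%N ->
  remainder n (x, x) <= remainder k (x, x).
Proof.
elim: n => [|n ih]; first by rewrite leqn0 => /eqP ->.
rewrite leq_eqVlt => /predU1P[->//|/ih]; apply: le_trans.
exact: schur_diag_le (semidefinite_remainder n).
Qed.

Lemma kernel_bounded : exists2 B : R, 0 <= B & forall x, H (x, x) <= B.
Proof.
have cdiag : continuous (fun x => H (x, x)).
  move=> x; apply: (@continuous_comp _ _ _ (fun x => (x, x)) H).
    by apply: cvg_pair; exact: cvg_id.
  exact: kH.1.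
have [_ [B HB]] := continuous_bounded_measurable cT cdiag.
exists B; first exact: le_trans (normr_ge0 _) (HB point).
by move=> x; apply: le_trans (HB x); exact: ler_norm.
Qed.

Lemma pivotP n y : remainder n (y, y) <= 2 * pivot_value n.
Proof.
rewrite /pivot_value /pivots /pivot; set P := (X in xget _ X).
suff PX : exists x, P x by exact: (xgetPex point PX).
pose D := [set remainder n (x, x) | x in setT].
have [B B0 HB] := kernel_bounded.
have supD : has_sup D.
  split; first by exists (remainder n (point, point)), point.
  exists B => _ [x _ <-]; apply: le_trans (HB x).
  exact: (@remainder_diag_le n 0).
have [D0|D0] := leP (sup D) 0.
  exists point => x; apply: (@le_trans _ _ 0).
    by apply: le_trans D0; apply: sup_upper_bound => //; exists x.
  by rewrite mulr_ge0//; exact: semidefinite_diag (semidefinite_remainder n).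
have D20 : 0 < sup D / 2 by rewrite divr_gt0.
have [_ [x _ <-] xD] := sup_adherent D20 supD.
exists x => z; have : remainder n (z, z) <= sup D.
  by apply: sup_upper_bound => //; exists z.
by lra.
Qed.

Lemma pivot_value_ge0 n : 0 <= pivot_value n.
Proof. exact: semidefinite_diag (semidefinite_remainder n). Qed.

(** The diagonal is then zero, and a semidefinite kernel is bounded by its
    diagonal: the algorithm has terminated. *)
Lemma pivot_value0 n : pivot_value n = 0 -> forall z, remainder n z = 0.
Proof.
move=> a0 [x y]; apply/eqP; rewrite -normr_le0.
apply: le_trans (semidefinite_norm x y (semidefinite_remainder n)) _.
by have := pivotP n x; have := pivotP n y; rewrite a0; lra.
Qed.

Lemma pivot_value_gt0 n k : (k <= n)%N ->
  0 < pivot_value n -> 0 < pivot_value k.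
Proof.
move=> kn an; have := remainder_diag_le (pivots n) kn.
rewrite -/(pivot_value n); have := pivotP k (pivots n); lra.
Qed.

(** The step at a pivot cancels the row of that pivot, and later steps subtract
    multiples of rows that vanish there. *)
Lemma remainder_pivot n k y : (k < n)%N -> remainder n (pivots k, y) = 0.
Proof.
elim: n y => [//|n ih] y; rewrite ltnS leq_eqVlt => /predU1P[->|kn].
  rewrite remainderS/=; have [a0|a0] := eqVneq (pivot_value n) 0.
    by rewrite !(pivot_value0 a0) mul0r mul0r subrr.
  by rewrite -/(pivot_value n) mulrAC mulfV// mul1r subrr.
by rewrite remainderS/= !ih// mul0r mul0r subrr.
Qed.

Lemma sqdist_remainder n x y : sqdist (remainder n) x y <= sqdist H x y.
Proof.
elim: n => [//|n ih]; apply: le_trans ih.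
exact: sqdist_schur (semidefinite_remainder n).
Qed.

Lemma sqdist_small (e : R) : 0 < e -> exists2 d : R, 0 < d &
  forall x y, ball x d y -> sqdist H x y < e.
Proof.
move=> e0; have e40 : 0 < e / 4 by rewrite divr_gt0.
have [d d0 hd] := kernel_uniform cT kH e40; exists d => // x y xy.
have := hd x _ _ xy; have := hd y _ _ xy; rewrite !ler_norml /sqdist.
rewrite (kH.2 y x) => /andP[? ?] /andP[? ?]; lra.
Qed.

(** Pivots with a large value are far apart, since an earlier pivot is
    orthogonal to the later remainder, and a compact space has room for only
    finitely many points far apart. *)
Lemma pivot_value_small (e : R) : 0 < e -> exists n, pivot_value n < e.
Proof.
move=> e0; apply: contrapT => /forallNP big.
have large n : e <= pivot_value n by rewrite leNgt; exact/negP/big.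
have [d d0 hd] := sqdist_small e0.
have far i j : (i < j)%N -> ~ ball (pivots i) d (pivots j).
  move=> ij /hd; apply/negP; rewrite -leNgt; apply: le_trans (large j) _.
  apply: le_trans (sqdist_remainder j _ _); rewrite /sqdist.
  by rewrite !(remainder_pivot _ ij) mulr0 subr0 add0r.
have d20 : 0 < d / 2 by rewrite divr_gt0.
have [k [z [A [_ Az pA]]]] := small_partition cT d20.
have /choice[g gA] : forall i : 'I_k.+1, exists l, A l (pivots i).
  by move=> i; have [l Al _] := pA (pivots i); exists l.
have /injectivePn[i [j ij gij]] : ~~ injectiveb g.
  apply/negP => /injectiveP /leq_card; rewrite !card_ord ltnn.
  by [].
wlog ltij : i j ij gij / (i < j)%N.
  move=> hw; have [|ji|ijE] := ltngtP i j; first exact: hw.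
    by apply: (hw j i) => //; rewrite eq_sym.
  by move/eqP: ij; apply; exact: val_inj.
apply: (far i j ltij); rewrite [d]splitr; apply: (@ball_triangle _ _ (z (g i))).
  by apply: ball_sym; apply: Az; exact: gA.
by rewrite gij; apply: Az; exact: gA.
Qed.

Lemma remainder_uniform (e : R) : 0 < e ->
  exists N, forall n, (N <= n)%N -> forall z, `|remainder n z| < e.
Proof.
move=> e0; have e20 : 0 < e / 2 by rewrite divr_gt0.
have [N aN] := pivot_value_small e20; exists N => n Nn [x y].
have small w : remainder n (w, w) < e.
  have := remainder_diag_le w Nn; have := pivotP N w; lra.
have := semidefinite_norm x y (semidefinite_remainder n).
have := small x; have := small y; lra.
Qed.

Definition cholesky_term n (z : T * T) : R :=
  (pivot_value n)^-1 * remainder n (z.1, pivots n) *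
  remainder n (z.2, pivots n).

Lemma cholesky_termE n z : cholesky_term n z = remainder n z - remainder n.+1 z.
Proof.
rewrite remainderS /cholesky_term ((semidefinite_remainder n).1 (pivots n)).
by ring.
Qed.

Lemma sum_cholesky_term n z :
  \sum_(0 <= j < n) cholesky_term j z = H z - remainder n z.
Proof.
elim: n => [|n ih]; first by rewrite big_nil subrr.
by rewrite big_nat_recr//= ih cholesky_termE addrA subrK.
Qed.

(** The coefficient is nonnegative, and [2 * `|a * b| <= a ^+ 2 + b ^+ 2]. *)
Lemma cholesky_term_norm n x y : `|cholesky_term n (x, y)| <=
  (cholesky_term n (x, x) + cholesky_term n (y, y)) / 2.
Proof.
rewrite /cholesky_term/= -!mulrA -mulrDr -mulrA normrM ger0_norm; last first.
  by rewrite invr_ge0 pivot_value_ge0.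
rewrite ler_wpM2l ?invr_ge0 ?pivot_value_ge0// -!expr2.
move: (remainder n (x, _)) (remainder n (y, _)) => a b.
have := sqr_ge0 (a + b); have := sqr_ge0 (a - b).
by rewrite sqrrB sqrrD ler_norml => h1 h2; apply/andP; split; lra.
Qed.

(** On the diagonal the terms are nonnegative and their partial sums stay below
    that of [H]. *)
Lemma sum_cholesky_norm n x y :
  \sum_(0 <= j < n) `|cholesky_term j (x, y)| <= (H (x, x) + H (y, y)) / 2.
Proof.
apply: (@le_trans _ _ (\sum_(0 <= j < n)
    (cholesky_term j (x, x) + cholesky_term j (y, y)) / 2)).
  by apply: ler_sum => j _; exact: cholesky_term_norm.
rewrite -mulr_suml big_split/= !sum_cholesky_term ler_wpM2r ?invr_ge0//.
have := semidefinite_diag x (semidefinite_remainder n).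
have := semidefinite_diag y (semidefinite_remainder n); lra.
Qed.

Lemma remainder_section_continuous n x :
  continuous (fun y => remainder n (x, y)).
Proof.
elim: n x => [|n ih] x y; first exact: kernel_section_continuous kH x y.
apply: cvgB; first exact: ih.
by apply: cvgM; [apply: cvgM; [exact: cvg_cst|exact: ih]|exact: cvg_cst].
Qed.

Lemma remainder_section_bm n x :
  bounded_measurable (fun y : borel T => remainder n (x, y)).
Proof.
exact: (continuous_bounded_measurable cT (@remainder_section_continuous n x)).
Qed.

(** Every remainder has rows that are combinations of rows of [H]. *)
Lemma remainder_null n x :
  cintegral (of_probability mu) (fun y => remainder n (x, y)) = 0.
Proof.
elim: n x => [//|n ih] x.
have -> : (fun y => remainder n.+1 (x, y)) = fun y => remainder n (x, y) -
    remainder n (x, pivots n) / pivot_value n * remainder n (pivots n, y).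
  by apply/funext => y; rewrite remainderS mulrAC.
rewrite cintegralB ?cintegralZ ?ih ?mulr0 ?subr0//.
- exact: remainder_section_bm.
- exact: remainder_section_bm.
- by apply: bounded_measurableZ; exact: remainder_section_bm.
Qed.

(** A row of the remainder is positive at its pivot but has integral zero, and
    every nonempty open set has positive measure. *)
Lemma remainder_lt0 n : 0 < pivot_value n ->
  exists y, remainder n (pivots n, y) < 0.
Proof.
move=> a0; apply: contrapT => /forallNP neg.
have row0 y : 0 <= remainder n (pivots n, y) by rewrite leNgt; exact/negP/neg.
pose f y := remainder n (pivots n, y); pose a := pivot_value n.
have [d d0 fd] : exists2 d : R, 0 < d &
    forall y, ball (pivots n) d y -> a / 2 <= f y.
  have a20 : 0 < a / 2 by rewrite divr_gt0.
  have /cvgrPdist_lt /(_ _ a20) /nbhs_ballP[d /= d0 hd] :=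
    @remainder_section_continuous n (pivots n) (pivots n).
  exists d => // y /hd; rewrite /= -/(pivot_value n) -/a -/(f y).
  by rewrite ltr_norml => /andP[? ?]; lra.
have mB : measurable (ball (pivots n) d : set (borel T)) by exact: borel_ball.
have : a / 2 * fine (mu (ball (pivots n) d)) <= 0.
  rewrite -(remainder_null n (pivots n)) -(fine_of_probability mu).
  rewrite -cintegral_indic// -cintegralZ; last exact: bounded_measurable_indic.
  have b1 : bounded_measurable
      (fun x : borel T => a / 2 * \1_(ball (pivots n) d) x).
    by apply: bounded_measurableZ; exact: bounded_measurable_indic.
  rewrite !cintegral_of_probability//; last exact: remainder_section_bm.
  apply: le_Rintegral => //.
  - exact: bounded_measurable_integrable.
  - by apply: bounded_measurable_integrable; exact: remainder_section_bm.
  - move=> y _; rewrite indicE; have [By|By] := pselect (ball (pivots n) d y).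
      by rewrite mem_set// mulr1; exact: fd.
    by rewrite memNset// mulr0; exact: row0.
apply/negP; rewrite -ltNge mulr_gt0 ?divr_gt0//.
exact: mu_ball_gt0.
Qed.

(** The pivots up to [n] are distinct, and the row of the last one is negative
    at yet another point. *)
Lemma pivot_value_L2_dim n : 0 < pivot_value n ->
  (n.+1%:R%:E < L2_dim mu)%E.
Proof.
move=> a0; have [y ylt0] := remainder_lt0 a0.
pose z (i : 'I_n.+2) := if (i <= n)%N then pivots i else y.
suff zI : injective z.
  apply: lt_le_trans (L2_dim_ge supp_mu zI).
  by rewrite lte_fin ltr_nat.
suff zlt (i j : 'I_n.+2) : (i < j)%N -> z i <> z j.
  move=> i j zij; have [|ji|/val_inj//] := ltngtP i j; first by move/zlt.
  by have := zlt _ _ ji; rewrite zij.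
move=> ij; have iN : (i <= n)%N by rewrite -ltnS (leq_trans ij)// -ltnS.
rewrite /z iN; case: ifPn => [jn ijE|jn yE].
  have := pivot_value_gt0 jn a0; rewrite /pivot_value -ijE.
  by rewrite remainder_pivot ?ltxx// ijE.
have := ylt0; rewrite -yE; move: iN; rewrite leq_eqVlt => /predU1P[->|iN].
  by rewrite ltNge pivot_value_ge0.
by rewrite (semidefinite_remainder n).1 remainder_pivot// ltxx.
Qed.

End pivoted_cholesky.

(** * The equivalences *)

Section expansion_of_semidefinite.
Context (R : realType) (T : pmetricType R).
Hypothesis cT : compact [set: T].
Variables (H : T * T -> R) (mu : probability (borel T) R).
Hypothesis kH : is_kernel H.
Hypothesis sdH : semidefinite H.
Hypothesis supp_mu : supp mu = setT.
Hypothesis nullH : forall x,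
  cintegral (of_probability mu) (fun y => H (x, y)) = 0.

(** A term whose index reaches the dimension of L^2 belongs to a zero pivot, and
    is zero because its coefficient is the inverse of zero; dropping it changes
    nothing. *)
Lemma semidefinite_expansion (C : R) : has_expansion mu (fun z => H z + C).
Proof.
pose lambda j := if j is j'.+1 then (pivot_value H j')^-1 else C.
pose phi j x := if j is j'.+1 then remainder H j' (x, pivots H j') else 1.
pose u := expansion_term mu lambda phi.
have u0 z : u 0%N z = C.
  have d0 : (0%N%:R%:E < L2_dim mu)%E.
    have pI : injective (fun _ : 'I_1 => point : T).
      by move=> i j; rewrite !ord1.
    by apply: lt_le_trans (L2_dim_ge supp_mu pI); rewrite lte_fin ltr0n.
  by rewrite /u /expansion_term d0 /lambda /phi !mulr1.
have uS j z : u j.+1 z = cholesky_term H j z.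
  rewrite /u /expansion_term; case: ifPn => // nd.
  have a0 : pivot_value H j = 0.
    apply/eqP; rewrite eq_le (pivot_value_ge0 sdH) andbT leNgt.
    apply: contra nd; exact: pivot_value_L2_dim.
  by rewrite /cholesky_term a0 invr0 !mul0r.
have sumu n z : \sum_(0 <= j < n.+1) u j z = H z + C - remainder H n z.
  rewrite big_nat_recl//= u0 (eq_bigr (fun j => cholesky_term H j z)) => [|j _].
    by rewrite (sum_cholesky_term sdH); ring.
  exact: uS.
exists lambda, phi; rewrite -/u; split.
- apply/uniform_cvgnP => e e0; have [N hN] := remainder_uniform cT kH sdH e0.
  exists N.+1 => // -[//|n] /= Nn z; rewrite sumu subKr; exact: hN.
- move=> -[x y]; apply: nondecreasing_is_cvgn.
    by apply/nondecreasing_seqP => n; rewrite /series/= big_nat_recr//= lerDl.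
  exists (`|C| + (H (x, x) + H (y, y)) / 2) => _ [n _ <-]; rewrite /series/=.
  apply: (@le_trans _ _ (\sum_(0 <= j < n.+1) `|u j (x, y)|)).
    by rewrite big_nat_recr//= lerDl.
  rewrite big_nat_recl//= u0 lerD2l.
  rewrite (eq_bigr (fun j => `|cholesky_term H j (x, y)|)) => [|j _].
    exact: sum_cholesky_norm.
  by rewrite uS.
- by exists 1.
- by move=> [//|j] _ _; rewrite /lambda invr_ge0 (pivot_value_ge0 sdH).
Qed.

End expansion_of_semidefinite.

Section equivalences.
Context (R : realType) (T : pmetricType R).
Hypothesis cT : compact [set: T].
Variables (K : T * T -> R) (mu : probability (borel T) R).
Hypothesis kK : is_kernel K.
Hypothesis invK : invariant_measure K (of_probability mu).
Hypothesis supp_mu : supp mu = setT.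
Local Notation charges := (charge (borel T) R).
Implicit Types (nu : charges).
Local Notation m := (of_probability mu).
Let P := @probabilities R T.
Let Q := @signed_probabilities R T.

Lemma conditionally_expansion :
  conditionally_positive_definite K -> has_expansion mu K.
Proof.
move=> cpd; pose C := energy K m; pose H : T * T -> R := fun z => K z - C.
have kH : is_kernel H by exact: is_kernelD.
have pH := conditionally_positive_shift cT kK invK cpd.
have sdH : semidefinite H.
  split; first exact: kH.2.
  move=> s; rewrite -(energy_dirac cT kH); apply: pH.
  by rewrite signed_measuresT.
have -> : K = fun z => H z + C by apply/funext => z; rewrite /H subrK.
apply: semidefinite_expansion => // x.
have := potential_addC cT kK (- C) m x; rewrite /potential => ->.
have := invK x; rewrite /potential => ->.
by rewrite fine_of_probability fine_probability_setT mulr1 subrr.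
Qed.

Lemma signed_probabilitiesP nu : Q nu <-> fine (nu setT) = 1.
Proof.
split=> [[_ ->]//|nu1]; split; first by rewrite signed_measuresT.
by rewrite -(fineK (charge_fin_num nu measurableT)) nu1.
Qed.

Lemma probabilities_signed nu : P nu -> Q nu.
Proof.
by move=> [p _ <-]; apply/signed_probabilitiesP/fine_probability_setT.
Qed.

(** The difference of the two sides is half the energy of [nu - nu']. *)
Lemma conditionally_midpoint nu nu' : conditionally_positive_definite K ->
  Q nu -> Q nu' -> midpoint_inequality K nu nu'.
Proof.
move=> cpd /signed_probabilitiesP nu1 /signed_probabilitiesP nu'1.
have : neutral_measures (cadd nu (cscale (-1) nu')).
  apply/(neutralP cT); rewrite fine_cadd// fine_cscale// mulN1r.
  by apply/eqP; rewrite subr_eq0 nu1 nu'1.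
move=> /cpd; rewrite (energyDZ cT kK) /midpoint_inequality.
by rewrite sqrrN expr1n mul1r => h; lra.
Qed.

(** The difference of the two sides is [t * (1 - t)] times the energy of the
    difference of the two charges. *)
Lemma midpoint_convex nu nu' t : midpoint_inequality K nu nu' -> 0 <= t <= 1 ->
  energy K (mix t nu nu') <= (1 - t) * energy K nu + t * energy K nu'.
Proof.
rewrite /midpoint_inequality (energy_mix cT kK) => h /andP[t0 t1].
have : 0 <= (1 - t) * t *
    (energy K nu + energy K nu' - 2 * mutual_energy K nu nu').
  apply: mulr_ge0; last by lra.
  by apply: mulr_ge0 => //; rewrite subr_ge0.
move: (energy K nu) (energy K nu') (mutual_energy K nu nu') => a b c {h} h.
rewrite -subr_ge0; suff -> : (1 - t) * a + t * b - ((1 - t) ^+ 2 * a +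
  2 * ((1 - t) * t) * c + t ^+ 2 * b) = (1 - t) * t * (a + b - 2 * c) by [].
by ring.
Qed.

Lemma energy_mix_invariant t nu : Q nu ->
  energy K (mix t m nu) = energy K m + t ^+ 2 * (energy K nu - energy K m).
Proof.
move=> /signed_probabilitiesP nu1; rewrite (energy_mix cT kK).
by rewrite (mutual_energy_invariant kK invK) nu1; ring.
Qed.

Lemma conditionally_minimizer nu : conditionally_positive_definite K ->
  Q nu -> energy K m <= energy K nu.
Proof.
move=> cpd Qnu; have Qm : Q m by apply: probabilities_signed; exists mu.
have := conditionally_midpoint cpd Qm Qnu; rewrite /midpoint_inequality.
rewrite (mutual_energy_invariant kK invK).
by move: Qnu => /signed_probabilitiesP ->; lra.
Qed.

Lemma minimizer_conditionally :
  (forall nu, P nu -> energy K m <= energy K nu) ->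
  conditionally_positive_definite K.
Proof.
move=> h; apply: (global_minimizer_conditionally cT kK invK supp_mu).
by split => //; exists mu.
Qed.

Lemma local_minimizer_conditionally : local_minimizer K m ->
  conditionally_positive_definite K.
Proof.
move=> [_ loc]; apply: minimizer_conditionally => nu Pnu.
have [t [/andP[t0 _] /(_ t)]] := loc nu Pnu.
rewrite lexx (ltW t0) => /(_ isT).
rewrite energy_mix_invariant; last exact: probabilities_signed.
by rewrite lerDl pmulr_rge0 ?subr_ge0// exprn_gt0.
Qed.

Lemma convex_at_conditionally : energy_convex_at K m ->
  conditionally_positive_definite K.
Proof.
move=> [_ conv]; apply: minimizer_conditionally => nu Pnu.
have [t [/andP[t0 t1] /(_ (t / 2))]] := conv nu Pnu.
have /[swap]/[apply] : 0 <= t / 2 < t by apply/andP; split; lra.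
rewrite energy_mix_invariant; last exact: probabilities_signed.
move: (energy K nu) (energy K m) => a b h; rewrite -subr_ge0.
suff : 0 <= t / 2 * (1 - t / 2) * (a - b).
  by rewrite pmulr_rge0// mulr_gt0//; lra.
suff -> : t / 2 * (1 - t / 2) * (a - b) =
  (1 - t / 2) * b + t / 2 * a - (b + (t / 2) ^+ 2 * (a - b)).
  by rewrite subr_ge0.
by ring.
Qed.

Lemma midpoint_at_conditionally :
  (forall nu, P nu -> midpoint_inequality K m nu) ->
  conditionally_positive_definite K.
Proof.
move=> h; apply: minimizer_conditionally => nu Pnu; have := h nu Pnu.
rewrite /midpoint_inequality (mutual_energy_invariant kK invK).
by move: (probabilities_signed Pnu) => /signed_probabilitiesP ->; lra.
Qed.

Lemma convex_on_convex_at S : energy_convex_on S K ->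
  (forall nu, P nu -> S nu) -> energy_convex_at K m.
Proof.
move=> conv PS; have Pm : P m by exists mu.
split => // nu Pnu; exists 1; split; first by rewrite ltr01 lexx.
move=> t /andP[t0 t1]; apply: conv; [exact: PS|exact: PS|].
by rewrite t0 ltW.
Qed.

End equivalences.

Theorem theorem4p1 (R : realType) (T : pmetricType R) (K : T * T -> R)
    (mu : probability (borel T) R) :
  compact [set: T] -> is_kernel K ->
  invariant_measure K (of_probability mu) -> supp mu = [set: T] ->
  let P := @probabilities R T in
  let Q := @signed_probabilities R T in
  let m := of_probability mu in
  [<-> positive_definite_mod_constant K;
       conditionally_positive_definite K;
       local_minimizer K m;
       global_minimizer_over P K m;
       global_minimizer_over Q K m;
       energy_convex_on P K;
       energy_convex_on Q K;
       energy_convex_at K m;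
       forall mu1 mu2, P mu1 -> P mu2 -> midpoint_inequality K mu1 mu2;
       forall mu1 mu2, Q mu1 -> Q mu2 -> midpoint_inequality K mu1 mu2;
       forall mu2, P mu2 -> midpoint_inequality K m mu2;
       has_expansion mu K].
Proof.
move=> cT kK invK smu P Q m.
have Pm : P m by exists mu.
have PQ := @probabilities_signed R T cT.
have Qm : Q m by exact: PQ.
have minP := minimizer_conditionally cT kK invK smu.
have mid := conditionally_midpoint cT kK.
have conv nu nu' t : conditionally_positive_definite K -> Q nu -> Q nu' ->
    0 <= t <= 1 ->
    energy K (mix t nu nu') <= (1 - t) * energy K nu + t * energy K nu'.
  by move=> cpd Qn Qn'; apply: (midpoint_convex cT kK); exact: mid.
have min := conditionally_minimizer cT kK invK.
have convex_at := convex_at_conditionally cT kK invK smu.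
tfae.
- exact: positive_mod_constant_conditionally.
- move=> cpd; split => // nu Pnu; exists 1; split; first by rewrite ltr01 lexx.
  move=> t _; rewrite (energy_mix_invariant cT kK invK); last exact: PQ.
  by rewrite lerDl mulr_ge0 ?sqr_ge0// subr_ge0 min//; exact: PQ.
- move=> /(local_minimizer_conditionally cT kK invK smu) cpd.
  by split => // nu Pnu; apply: min => //; exact: PQ.
- move=> [_ /minP cpd].
  by split => // nu Qnu; exact: min.
- move=> [_ h]; have cpd : conditionally_positive_definite K.
    by apply: minP => nu Pnu; apply: h; exact: PQ.
  by move=> nu nu' Pnu Pnu' t; apply: conv => //; exact: PQ.
- move=> /convex_on_convex_at/(_ (fun=> id))/convex_at cpd.
  by move=> nu nu' Qnu Qnu' t; exact: conv.
- by move=> /convex_on_convex_at; apply; exact: PQ.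
- move=> /convex_at cpd nu nu' Pnu Pnu'.
  by apply: mid => //; exact: PQ.
- move=> h; have cpd : conditionally_positive_definite K.
    by apply: (midpoint_at_conditionally cT kK invK smu) => nu; exact: h.
  by move=> nu nu' Qnu Qnu'; exact: mid.
- by move=> h nu Pnu; apply: h => //; exact: PQ.
- move=> /(midpoint_at_conditionally cT kK invK smu).
  exact: conditionally_expansion.
- move=> /(expansion_conditionally cT kK) cpd.
  exists (- energy K m); exact: conditionally_positive_shift.
Qed.
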